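(* Let $T$ be a regular $s$-interval exchange transformation on $[\ell,r[$. A semi-interval $I\subset[\ell,r[$ is admissible for $T$ if and only if there exists a word $\chi\in\{\varphi,\psi\}^*$ such that $I$ is the domain of $\chi(T)$. In this case, the transformation induced by $T$ on $I$ is $\chi(T)$.
   Context: Let $A$ be a finite alphabet of cardinality $s$ with two total orders $<_1,<_2$; write $A=\{a_1<_1\cdots<_1a_s\}$. A semi-interval is $[\alpha,\beta[=\{z:\alpha\le z<\beta\}$. An $s$-interval exchange transformation $T$ on $[\ell,r[$ is given by a partition $(I_a)_{a\in A}$ of $[\ell,r[$ into semi-intervals $I_a=[\gamma_a,\mu_a[$ of lengths $\lambda_a>0$ placed left to right in the order $<_1$; with $\nu_a=\ell+\sum_{b\le_2a}\lambda_b$, $T(z)=z+\nu_a-\mu_a$ on $I_a$, so $T$ maps $I_a$ onto $J_a=[\delta_a,\nu_a[$, $\delta_a=\nu_a-\lambda_a$. Write $\gamma_i=\gamma_{a_i}$; separation points $\gamma_1=\ell,\dots,\gamma_s$. $T$ is regular if the orbits $\{T^n(\gamma_i):n\in\mathbb Z\}$, $2\le i\le s$, are infinite and pairwise disjoint; regular implies minimal. For minimal $T$ and a semi-interval $I$, the transformation induced by $T$ on $I$ is the first return map $S(z)=T^n(z)$, $n=\min\{n>0:T^n(z)\in I\}$, with domain $D(S)=I$. Admissibility: for $I=[u,v[$ and $z\in[\ell,r[$ let $\rho^+_{I,T}(z)=\min\{n>0:T^n(z)\in\,]u,v[\}$, $\rho^-_{I,T}(z)=\min\{n\ge0:T^{-n}(z)\in\,]u,v[\}$,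 $E_{I,T}(z)=\{k:-\rho^-_{I,T}(z)\le k<\rho^+_{I,T}(z)\}$, $N_{I,T}(z)=\{T^k(z):k\in E_{I,T}(z)\}$, $\mathrm{Div}(I,T)=\bigcup_{i=1}^sN_{I,T}(\gamma_i)$; $I=[u,v[$ with $\ell\le u<v\le r$ is admissible for $T$ if $u,v\in\mathrm{Div}(I,T)\cup\{r\}$. Rauzy inductions: let $b_{\max}$ and $b_{\min}$ be the $<_2$-largest and $<_2$-smallest letters. The right Rauzy induction $\psi(T)$ is the transformation induced by $T$ on $Z(T)=[\ell,\max\{\gamma_{a_s},\delta_{b_{\max}}\}[$; the left Rauzy induction $\varphi(T)$ is the transformation induced by $T$ on $Y(T)=[\min\{\mu_{a_1},\nu_{b_{\min}}\},r[$. Each of these is again a regular $s$-interval exchange transformation (on its own domain, with its own orders), so they can be iterated; for a word $\chi=\chi_1\cdots\chi_n\in\{\varphi,\psi\}^*$, $\chi(T)=\chi_1(\chi_2(\cdots\chi_n(T)\cdots))$, and for the empty word $\chi(T)=T$. *)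

(* Defs.v *)
From HB Require Import structures.
From mathcomp Require Import all_boot all_order all_algebra.
From mathcomp Require Import all_classical all_reals all_analysis.
From mathcomp Require Import lra.
Set Implicit Arguments.
Unset Strict Implicit.
Unset Printing Implicit Defensive.
Import Order.TTheory GRing.Theory Num.Theory.
Local Open Scope classical_set_scope.
Local Open Scope ring_scope.

(* [le1] and [le2] are the reflexive versions of the two total orders.  The
   partition is determined by the left end point, the lengths and [le1]. *)
Record iet (R : realType) (A : finType) := Iet {
  left_end : R;
  len : A -> R;
  le1 : rel A;
  le2 : rel A;
  alphabet_gt0 : (0 < #|A|)%N;
  len_gt0 : forall a, 0 < len a;
  le1_anti : antisymmetric le1;
  le1_trans : transitive le1;
  le1_total : total le1;
  le2_anti : antisymmetric le2;
  le2_trans : transitive le2;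
  le2_total : total le2 }.

Definition least (A : Type) (le : rel A) (a : A) : Prop := forall b, le a b.
Definition greatest (A : Type) (le : rel A) (a : A) : Prop := forall b, le b a.

Section Iet.
Variables (R : realType) (A : finType).
Implicit Types (T S : iet R A) (a b : A) (z u v : R) (I : set R) (n m : nat).

Definition right_end T : R := left_end T + \sum_b len T b.

Definition iet_dom T : set R := `[left_end T, right_end T[.

(* I_a = [gamma a, mu a[ and J_a = [delta a, nu a[ *)
Definition mu T a : R := left_end T + \sum_(b | le1 T b a) len T b.
Definition gamma T a : R := mu T a - len T a.
Definition nu T a : R := left_end T + \sum_(b | le2 T b a) len T b.
Definition delta T a : R := nu T a - len T a.

Definition piece T a : set R := `[gamma T a, mu T a[.

(* Extended by the identity outside [iet_dom T]. *)
Definition iet_map T z : R :=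
  if [pick a | gamma T a <= z < mu T a] is Some a
  then z + nu T a - mu T a else z.

Definition iet_inv T z : R :=
  if [pick a | delta T a <= z < nu T a] is Some a
  then z + mu T a - nu T a else z.

Lemma piece_uniq (le : rel A) (l : R) (w : A -> R) a b z :
  antisymmetric le -> transitive le -> total le -> (forall c, 0 < w c) ->
  let m c := l + \sum_(d | le d c) w d in
  m a - w a <= z < m a -> m b - w b <= z < m b -> a = b.
Proof.
move=> leA leT leV w_gt0 m.
wlog le_ab : a b / le a b.
  move=> H za zb; case/orP: (leV a b) => [/H|/H] h; first exact: h.
  exact/esym/h.
move=> /andP[_ za] /andP[zb _]; case: (eqVneq a b) => // neq_ab; exfalso.
suff : m a <= m b - w b.
  by move=> /le_trans /(_ zb) /(lt_le_trans za); rewrite ltxx.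
have le_bb : le b b by case/orP: (leV b b).
rewrite /m [X in _ <= _ + X - _](bigD1 b) //= (addrC (w b)) addrA addrK lerD2l.
rewrite [leRHS](bigID (le^~ a)) /= -[leLHS]addr0 lerD //; last first.
  by apply: sumr_ge0 => c _; exact: ltW.
rewrite le_eqVlt; apply/orP; left; apply/eqP; apply: eq_bigl => c.
apply/idP/idP => [ca|/andP[]//]; rewrite ca (leT _ _ _ ca le_ab) /= andbT.
apply: contraNneq neq_ab => cb; apply/eqP; apply: leA.
by rewrite le_ab -cb ca.
Qed.

(* This holds in particular for z in [iet_dom T], which the pieces cover. *)
Lemma iet_mapK T a z : piece T a z -> iet_inv T (iet_map T z) = z.
Proof.
rewrite /piece /= in_itv /= => za; rewrite /iet_map.
case: pickP => [b zb|/(_ a)]; last by rewrite za.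
have nub : delta T b <= z + nu T b - mu T b < nu T b.
  by move: zb; rewrite /delta /gamma => /andP[? ?]; apply/andP; split; lra.
rewrite /iet_inv; case: pickP => [c zc|/(_ b)]; last by rewrite nub.
have <- : b = c by apply: (piece_uniq (@le2_anti _ _ T) (@le2_trans _ _ T)
  (@le2_total _ _ T) (@len_gt0 _ _ T) nub zc).
by lra.
Qed.

Definition iterz T (k : int) z : R :=
  match k with
  | Posz n => iter n (iet_map T) z
  | Negz n => iter n.+1 (iet_inv T) z
  end.

Definition iet_orbit T z : set R := [set iterz T k z | k in [set: int]].

Definition iet_regular T : Prop :=
  (forall a, ~ least (le1 T) a -> infinite_set (iet_orbit T (gamma T a))) /\
  trivIset [set a | ~ least (le1 T) a] (fun a => iet_orbit T (gamma T a)).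

(* The infimum makes rho +oo when no iterate of z ever lies in ]u, v[. *)
Definition rho_plus T u v z : \bar R :=
  ereal_inf [set n%:R%:E | n in
    [set n : nat | (0 < n)%N /\ `]u, v[%classic (iterz T n%:Z z)]].

Definition rho_minus T u v z : \bar R :=
  ereal_inf [set n%:R%:E | n in
    [set n : nat | `]u, v[%classic (iterz T (- n%:Z) z)]].

Definition visit_free_times T u v z : set int :=
  [set k : int | (- rho_minus T u v z <= (k%:~R)%:E < rho_plus T u v z)%E].

Definition neighbors T u v z : set R :=
  [set iterz T k z | k in visit_free_times T u v z].

Definition Div T u v : set R :=
  \bigcup_(a in [set: A]) neighbors T u v (gamma T a).

Definition admissible T u v : Prop :=
  [/\ left_end T <= u, u < v, v <= right_end T,
      (Div T u v `|` [set right_end T]) u &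
      (Div T u v `|` [set right_end T]) v].

Definition return_time T I z n : Prop :=
  [/\ (0 < n)%N, I (iter n (iet_map T) z) &
      forall m, (0 < m < n)%N -> ~ I (iter m (iet_map T) z)].

(* S, as a transformation, is the transformation induced by T on I. *)
Definition is_induced T I S : Prop :=
  iet_dom S = I /\
  forall z, I z -> exists2 n, return_time T I z n &
    iet_map S z = iter n (iet_map T) z.

(* The intervals exchanged by S are the classes of points of I whose T-orbits
   visit the same intervals of T up to their first return to I.  The map alone
   does not determine them: a regular T may be continuous at some gamma_i
   (e.g. a rotation with a marked point), and then its map has many
   presentations with the same number of intervals. *)
Definition same_itinerary_pieces T I S : Prop :=
  forall x y, I x -> I y ->
    (exists a, piece S a x /\ piece S a y) <->
    (exists n, [/\ return_time T I x n, return_time T I y n &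
       forall k, (k < n)%N -> exists b,
         piece T b (iter k (iet_map T) x) /\
         piece T b (iter k (iet_map T) y)]).

Definition is_induced_iet T I S : Prop :=
  is_induced T I S /\ same_itinerary_pieces T I S.

(* These are relations, S being determined only up to a renaming of letters. *)
Definition right_rauzy T S : Prop :=
  exists a b, [/\ greatest (le1 T) a, greatest (le2 T) b &
    is_induced_iet T `[left_end T, Num.max (gamma T a) (delta T b)[ S].

Definition left_rauzy T S : Prop :=
  exists a b, [/\ least (le1 T) a, least (le2 T) b &
    is_induced_iet T `[Num.min (mu T a) (nu T b), right_end T[ S].

End Iet.

Inductive rauzy := phi | psi.

Definition rauzy_step (R : realType) (A : finType) (c : rauzy) :
    iet R A -> iet R A -> Prop :=
  match c with phi => @left_rauzy R A | psi => @right_rauzy R A end.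

(* [rauzy_word chi T S] means S = chi(T); the head of chi is applied last. *)
Fixpoint rauzy_word (R : realType) (A : finType) (chi : seq rauzy)
    (T S : iet R A) : Prop :=
  match chi with
  | [::] => S = T
  | c :: chi' => exists2 U, rauzy_word chi' T U & rauzy_step c U S
  end.

(* Main.v *)
(* Call two points of one orbit linked when no point of ]u, v[ is
   visited on the way from the earlier to the later one; Div(I, T) is then the
   set of points linked to a separation point.  By Keane's theorem a regular T
   is minimal, so every separation point of T has a last previous visit to the
   interior of an admissible interval J.  These s - 1 visits are exactly the
   discontinuities of the first return itineraries, so T induces on J a regular
   s-interval exchange S, and Div(I, S) is the trace of Div(I, T) on J for every
   I inside J.  Hence admissibility for S and for T agree inside J.  The domains
   Z(T) and Y(T) are admissible, and an admissible I other than the whole domain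
   lies in one of them.  The corresponding Rauzy step removes a point from the
   finite set Div(I, T), so repeated steps end at I. *)
Require Import Defs.
From mathcomp Require Import all_boot all_order all_algebra.
From mathcomp Require Import all_classical all_reals all_analysis.
From mathcomp Require Import lra zify.
Set Implicit Arguments.
Unset Strict Implicit.
Unset Printing Implicit Defensive.
Import Order.TTheory GRing.Theory Num.Theory.
Local Open Scope classical_set_scope.
Local Open Scope ring_scope.

(** * Pieces of an interval exchange *)

(** The obstacle is a circularity: last previous visits exist by minimality, and minimality concerns
    arbitrary semi-intervals, whose end points need not be linked to separation points. One rigidity
    argument breaks it. A cell of [[p, q[] without cuts is translated as a block until it returns.
    If [p] and [q] are themselves counted among the cutting points, this holds in every
    semi-interval and yields recurrence with bounded return times; the points whose orbit meets [[p,
    q[] then form a finite union of semi-intervals, and a boundary point of it would lie on an orbit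
    segment joining two separation points. If [p] and [q] are linked to separation points, the
    separation points alone cut, and the same argument describes the induced transformation. The end
    point [left_end T] is no separation point in the sense of regularity. With at least two letters
    it is the image of one; with a single letter [T] is the identity and is treated apart. *)

Section OrderSums.
Variables (R : realType) (A : finType) (le : rel A) (l : R) (w : A -> R).
Hypotheses (leA : antisymmetric le) (leT : transitive le) (leV : total le).
Hypothesis w_gt0 : forall a, 0 < w a.

Let m a := l + \sum_(d | le d a) w d.

Lemma le_reflexive : reflexive le.
Proof. by move=> a; case/orP: (leV a a). Qed.

Lemma psum_ge0 (P : pred A) : 0 <= \sum_(d | P d) w d.
Proof. by apply: sumr_ge0 => a _; exact: ltW. Qed.

Lemma psum_sub (P Q : pred A) : (forall a, P a -> Q a) ->
  \sum_(d | P d) w d <= \sum_(d | Q d) w d.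
Proof.
move=> PQ; rewrite [leRHS](bigID P) /= -[leLHS]addr0 lerD ?psum_ge0 //.
rewrite le_eqVlt; apply/orP; left; apply/eqP; apply: eq_bigl => a.
by apply/idP/idP => [Pa|/andP[]//]; rewrite Pa PQ.
Qed.

Lemma psumE a : m a - w a = l + \sum_(d | le d a && (d != a)) w d.
Proof. by rewrite /m (bigD1 a) ?le_reflexive //= (addrC (w a)) addrA addrK. Qed.

Lemma psum_sep a b : le a b -> a != b -> m a <= m b - w b.
Proof.
move=> ab nab; rewrite psumE lerD2l; apply: psum_sub => c ca.
rewrite (leT ca ab) /=; apply: contraNneq nab => cb; apply/eqP/leA.
by rewrite ab -cb ca.
Qed.

Lemma psum_left a : l <= m a - w a.
Proof. by rewrite psumE lerDl psum_ge0. Qed.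

Lemma psum_right a : m a <= l + \sum_b w b.
Proof. by rewrite lerD2l; apply: psum_sub. Qed.

Lemma psum_least a : least le a -> m a - w a = l.
Proof.
move=> la; rewrite psumE big_pred0 ?addr0// => d; apply/negP => /andP[da].
by move/eqP; apply; apply: leA; rewrite da la.
Qed.

Lemma psum_greatest a : greatest le a -> m a = l + \sum_b w b.
Proof. by move=> ga; congr (_ + _); apply: eq_bigl => b; exact: ga. Qed.

Lemma psum_nleast a : ~ least le a -> l < m a - w a.
Proof.
move=> na; have [b nab] : exists b, ~~ le a b.
  by apply: contrapT => h; apply: na => b; apply: contrapT => /negP nb; apply: h; exists b.
have ba : le b a by case/orP: (leV a b) => // h; rewrite h in nab.
have nE : b != a by apply: contraNneq nab => ->; exact: le_reflexive.
apply: lt_le_trans (psum_sep ba nE); apply: le_lt_trans (psum_left b) _.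
by rewrite gtrBl.
Qed.

Lemma ex_greatest : (0 < #|A|)%N -> exists a, greatest le a.
Proof.
move=> /card_gt0P[a0 _].
pose a := [arg max_(i > a0) m i]%O; exists a => b.
rewrite /a; case: arg_maxP => // i _ imax.
case/orP: (leV b i) => // ib; case: (eqVneq i b) => [->|nib]; first exact: le_reflexive.
have := psum_sep ib nib; have := imax b isT; have := w_gt0 b => /= h1 h2 h3; exfalso; lra.
Qed.

Lemma psum_cover z : (0 < #|A|)%N -> l <= z < l + \sum_b w b ->
  exists a, m a - w a <= z < m a.
Proof.
move=> /ex_greatest[g gg] /andP[lz zr].
have zg : z < m g by rewrite psum_greatest.
case: (@arg_minP _ _ _ g (fun a => z < m a) m zg) => a za amin.
exists a; rewrite za andbT leNgt; apply/negP => az.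
have la : l < m a - w a by exact: le_lt_trans lz az.
have [b ba nba] : exists2 b, le b a & b != a.
  apply: contrapT => h; move: la; rewrite psumE big_pred0 ?addr0 ?ltxx// => d.
  by apply/negP => /andP[da nda]; apply: h; exists d.
(* [c] will be the letter just before [a]: its piece ends where that of [a] begins, beyond [z],
   against the minimality of [m a]. *)
case: (@arg_maxP _ _ _ b (fun d => le d a && (d != a)) m).
  by rewrite ba nba.
move=> c /andP[ca nca] cmax.
suff E : m c = m a - w a by move: (amin c); rewrite E => /(_ az); have := w_gt0 a; lra.
rewrite psumE; congr (_ + _); apply: eq_bigl => d; apply/idP/idP => [dc|].
  rewrite (leT dc ca)/=; apply: contraNneq nca => da; apply/eqP/leA.
  by rewrite ca -da dc.
move=> /[dup] /cmax mdc _; case/orP: (leV d c) => // cd.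
case: (eqVneq c d) => [->|ncd]; first exact: le_reflexive.
by have := psum_sep cd ncd; have := w_gt0 d; move: mdc => /= ? ? ?; exfalso; lra.
Qed.

End OrderSums.

Section Basic.
Variables (R : realType) (A : finType).
Implicit Types (T : iet R A) (a b : A) (x y z : R).

(** Exchanging the orders gives the inverse transformation and turns [gamma], [mu] into [delta],
    [nu], all by conversion. Statements on backward orbits and on images of pieces are obtained from
    it. *)
Definition iet_rev T : iet R A :=
  Iet (left_end T) (alphabet_gt0 T) (@len_gt0 _ _ T)
    (@le2_anti _ _ T) (@le2_trans _ _ T) (@le2_total _ _ T)
    (@le1_anti _ _ T) (@le1_trans _ _ T) (@le1_total _ _ T).

Lemma iet_map_rev T : iet_map (iet_rev T) = iet_inv T.
Proof. by []. Qed.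

Lemma iet_domE T z : iet_dom T z = (left_end T <= z < right_end T) :> Prop.
Proof. by rewrite /iet_dom /= in_itv. Qed.

Lemma pieceE T a z : piece T a z = (gamma T a <= z < mu T a) :> Prop.
Proof. by rewrite /piece /= in_itv. Qed.

Lemma gamma_mu T a : gamma T a + len T a = mu T a.
Proof. by rewrite /gamma subrK. Qed.

Lemma delta_nu T a : delta T a + len T a = nu T a.
Proof. by rewrite /delta subrK. Qed.

Lemma gamma_lt_mu T a : gamma T a < mu T a.
Proof. by rewrite -gamma_mu ltrDl len_gt0. Qed.

Lemma left_le_gamma T a : left_end T <= gamma T a.
Proof. exact: psum_left (@le1_total _ _ T) (@len_gt0 _ _ T) a. Qed.

Lemma mu_le_right T a : mu T a <= right_end T.
Proof. exact: psum_right (@len_gt0 _ _ T) a. Qed.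

Lemma gamma_dom T a : iet_dom T (gamma T a).
Proof.
rewrite iet_domE left_le_gamma (lt_le_trans (gamma_lt_mu T a)) //.
exact: mu_le_right.
Qed.

Lemma left_lt_right T : left_end T < right_end T.
Proof.
have /card_gt0P[a _] := alphabet_gt0 T.
by have := gamma_dom T a; rewrite iet_domE; lra.
Qed.

Lemma gamma_least T a : least (Defs.le1 T) a -> gamma T a = left_end T.
Proof. exact: psum_least (@le1_anti _ _ T) (@le1_total _ _ T) a. Qed.

Lemma gamma_nleast T a : ~ least (Defs.le1 T) a -> left_end T < gamma T a.
Proof. exact: psum_nleast (@le1_anti _ _ T) (@le1_trans _ _ T) (@le1_total _ _ T) (@len_gt0 _ _ T) a. Qed.

Lemma piece_inj T a b z :
  gamma T a <= z < mu T a -> gamma T b <= z < mu T b -> a = b.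
Proof.
exact: (@piece_uniq _ _ (Defs.le1 T) (left_end T) (len T) a b z (@le1_anti _ _ T)
  (@le1_trans _ _ T) (@le1_total _ _ T) (@len_gt0 _ _ T)).
Qed.

Lemma gamma_inj T a b : gamma T a = gamma T b -> a = b.
Proof.
move=> E; apply: (@piece_inj T a b (gamma T a)); first by rewrite lexx gamma_lt_mu.
by rewrite E lexx gamma_lt_mu.
Qed.

Lemma piece_cover T z : iet_dom T z -> exists a, gamma T a <= z < mu T a.
Proof.
rewrite iet_domE => zT.
exact: (psum_cover (@le1_anti _ _ T) (@le1_trans _ _ T) (@le1_total _ _ T)
  (@len_gt0 _ _ T) (alphabet_gt0 T) zT).
Qed.

Lemma piece_dom T a z : gamma T a <= z < mu T a -> iet_dom T z.
Proof.
move=> /andP[gz zm]; rewrite iet_domE (le_trans (left_le_gamma T a) gz) /=.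
exact: lt_le_trans zm (mu_le_right T a).
Qed.

Lemma next_letter T a : mu T a < right_end T -> exists b, gamma T b = mu T a.
Proof.
move=> ar; have : iet_dom T (mu T a).
  by rewrite iet_domE ar andbT (le_trans (left_le_gamma T a)) ?ltW ?gamma_lt_mu.
move=> /piece_cover[b /andP[gb bm]]; exists b; apply/eqP; rewrite eq_le gb /=.
rewrite leNgt; apply/negP => lt_ba.
have E : a = b.
  apply: (@piece_inj T a b (Num.max (gamma T a) (gamma T b))).
    by rewrite le_max lexx gt_max gamma_lt_mu lt_ba.
  by rewrite le_max lexx orbT gt_max gamma_lt_mu (lt_trans (gamma_lt_mu T a) bm).
by move: bm; rewrite -E ltxx.
Qed.

Lemma iet_mapE T a z : gamma T a <= z < mu T a ->
  iet_map T z = z + (delta T a - gamma T a).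
Proof.
move=> za; rewrite /iet_map; case: pickP => [b zb|/(_ a)]; last by rewrite za.
by rewrite -(piece_inj za zb) -delta_nu -gamma_mu; lra.
Qed.

Lemma iet_map_gamma T a : iet_map T (gamma T a) = delta T a.
Proof. by rewrite (@iet_mapE T a) ?lexx ?gamma_lt_mu//; lra. Qed.

Lemma iet_map_out T z : ~ iet_dom T z -> iet_map T z = z.
Proof.
by move=> zT; rewrite /iet_map; case: pickP => // a /piece_dom.
Qed.

Lemma iet_map_dom T z : iet_dom T z -> iet_dom T (iet_map T z).
Proof.
move=> /piece_cover[a za]; rewrite (iet_mapE za).
apply: (@piece_dom (iet_rev T) a); move: za.
have -> : gamma (iet_rev T) a = delta T a by [].
have -> : mu (iet_rev T) a = nu T a by [].
by rewrite -gamma_mu -delta_nu; lra.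
Qed.

Lemma iet_mapVK T : cancel (iet_map T) (iet_inv T).
Proof.
move=> z; have [/piece_cover[a za]|nz] := pselect (iet_dom T z).
  by apply: (@iet_mapK _ _ T a); rewrite pieceE.
by rewrite (iet_map_out nz) -iet_map_rev iet_map_out.
Qed.

Lemma iet_mapKV T : cancel (iet_inv T) (iet_map T).
Proof. exact: (iet_mapVK (iet_rev T)). Qed.

Lemma iet_map_inj T : injective (iet_map T).
Proof. exact: can_inj (@iet_mapVK T). Qed.

Lemma iet_map_domE T z : iet_dom T (iet_map T z) -> iet_dom T z.
Proof. by move=> /(@iet_map_dom (iet_rev T)); rewrite iet_map_rev iet_mapVK. Qed.

Lemma iter_dom T n z : iet_dom T z -> iet_dom T (iter n (iet_map T) z).
Proof. by move=> zT; elim: n => //= n; exact: iet_map_dom. Qed.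

Lemma iter_domE T n z : iet_dom T (iter n (iet_map T) z) -> iet_dom T z.
Proof. by elim: n => //= n IH /iet_map_domE. Qed.

(** The least letter is excluded: for a regular [T] on at least two letters [left_end T] is the
    image of another [gamma T a], so Keane's condition would fail with it. *)
Definition sep T x := exists2 a, ~ least (Defs.le1 T) a & x = gamma T a.

Lemma sep_dom T x : sep T x -> left_end T < x < right_end T.
Proof.
move=> [a /gamma_nleast la ->].
by rewrite la /=; have := gamma_dom T a; rewrite iet_domE => /andP[].
Qed.

Lemma gamma_sep T a : left_end T < gamma T a -> sep T (gamma T a).
Proof. by move=> la; exists a => // /gamma_least E; move: la; rewrite E ltxx. Qed.

Lemma piece_sep T a x : gamma T a < x < mu T a -> ~ sep T x.
Proof.
move=> /andP[gx xm] [b _ E]; have ab : a = b.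
  by apply: (@piece_inj T a b x); rewrite ?(ltW gx)// E lexx gamma_lt_mu.
by move: gx; rewrite E ab ltxx.
Qed.

Lemma same_piece T x y : iet_dom T x -> iet_dom T y -> x <= y ->
  (forall s, sep T s -> ~ x < s <= y) ->
  exists a, gamma T a <= x /\ y < mu T a.
Proof.
move=> /piece_cover[a /andP[ax xa]]; rewrite iet_domE => /andP[_ yr] xy ns.
exists a; split => //; rewrite ltNge; apply/negP => ay.
have [b Eb] := next_letter (le_lt_trans ay yr).
apply: (ns (mu T a)); last by rewrite xa ay.
rewrite -Eb; apply: gamma_sep; rewrite Eb.
exact: le_lt_trans (left_le_gamma T a) (gamma_lt_mu T a).
Qed.

End Basic.

(** * Orbit arcs and separation points *)

Section Arcs.
Variables (X : Type) (f : X -> X).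
Implicit Types (O : set X) (x y z c : X).

(** The earlier point may lie in [O], the later one may not, just as [rho_minus] counts from 0 and
    [rho_plus] from 1. Hence a class of linked points meets [O] at most once, in its earliest
    point. *)
Definition fwd O x y :=
  exists2 n, y = iter n f x & forall j, (0 < j <= n)%N -> ~ O (iter j f x).

Definition arc O x y := fwd O x y \/ fwd O y x.

Lemma fwd_refl O x : fwd O x x.
Proof. by exists 0%N => // j; lia. Qed.

Lemma fwd_step O x : ~ O (f x) -> fwd O x (f x).
Proof. by move=> nO; exists 1%N => // j j1; have -> : j = 1%N by lia. Qed.

Lemma fwd_trans O x y z : fwd O x y -> fwd O y z -> fwd O x z.
Proof.
move=> [n -> hn] [m -> hm]; exists (m + n)%N; first by rewrite iterD.
move=> j j1; case: (leqP j n) => jn; first by apply: hn; lia.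
have -> : j = ((j - n) + n)%N by lia.
by rewrite iterD; apply: hm; lia.
Qed.

Lemma fwd_sub O O' x y : O `<=` O' -> fwd O' x y -> fwd O x y.
Proof. by move=> OO' [n -> h]; exists n => // j /h h1 /OO'. Qed.

Lemma arc_sub O O' x y : O `<=` O' -> arc O' x y -> arc O x y.
Proof. by move=> OO' [] /(fwd_sub OO'); [left|right]. Qed.

Lemma arc_sym O x y : arc O x y -> arc O y x.
Proof. by case; [right|left]. Qed.

Lemma fwd_branch O x y z : fwd O x y -> fwd O x z -> arc O y z.
Proof.
have H n m : (n <= m)%N -> (forall j, (0 < j <= m)%N -> ~ O (iter j f x)) ->
    fwd O (iter n f x) (iter m f x).
  move=> nm h; exists (m - n)%N; first by rewrite -iterD subnK.
  by move=> j j1; rewrite -iterD; apply: h; lia.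
move=> [n -> hn] [m -> hm]; case: (leqP n m) => nm; first by left; exact: H.
by right; apply: H => //; exact: ltnW.
Qed.

Lemma arc_fwd O c x : O c -> arc O c x -> fwd O c x.
Proof.
move=> Oc [//|[[|n] E h]]; first by rewrite E; exact: fwd_refl.
by exfalso; apply: (h n.+1); [lia | rewrite -E].
Qed.

Hypothesis f_inj : injective f.

Lemma iter_inj n : injective (iter n f).
Proof. by elim: n => // n IH x y /= /f_inj /IH. Qed.

Lemma fwd_merge O x y z : fwd O x z -> fwd O y z -> arc O x y.
Proof.
have H n m x' y' : (n <= m)%N -> iter n f x' = iter m f y' ->
    (forall j, (0 < j <= m)%N -> ~ O (iter j f y')) -> fwd O y' x'.
  move=> nm E h; exists (m - n)%N; last by move=> j j1; apply: h; lia.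
  by apply: (@iter_inj n); rewrite -iterD subnKC.
move=> [n -> hn] [m E hm]; case: (leqP n m) => nm; first by right; apply: (H n m).
by left; apply: (H m n) => //; exact: ltnW.
Qed.

Lemma arc_trans O x y z : arc O x y -> arc O y z -> arc O x z.
Proof.
case=> h1 [] h2.
- by left; exact: fwd_trans h2.
- exact: fwd_merge h1 h2.
- exact: fwd_branch h1 h2.
- by right; exact: fwd_trans h1.
Qed.

Lemma fwd_last_uniq O c c' x : O c -> O c' -> fwd O c x -> fwd O c' x -> c = c'.
Proof.
move=> Oc Oc' h h'; case: (fwd_merge h h') => -[[|n] E hn] //.
  by exfalso; apply: (hn n.+1); [lia|rewrite -E].
by exfalso; apply: (hn n.+1); [lia|rewrite -E].
Qed.

Lemma iter_eq_periodic i j x : (i < j)%N -> iter i f x = iter j f x ->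
  iter (j - i) f x = x.
Proof.
move=> ij E; apply: (@iter_inj i); rewrite -iterD subnKC //; exact: ltnW.
Qed.

End Arcs.

Lemma pigeonhole_seq (U : eqType) (s : seq U) (f : nat -> U) :
  (forall k, f k \in s) -> exists i j, (i < j)%N /\ f i = f j.
Proof.
move=> fs; apply: contrapT => h.
have inj : injective f.
  move=> i j E; apply: contrapT => nij; apply: h.
  by have [ij|ij|//] := ltngtP i j; [exists i, j | exists j, i].
have := @uniq_leq_size _ [seq f k | k <- iota 0 (size s).+1] s.
rewrite map_inj_uniq // iota_uniq size_map size_iota ltnn => H.
by have := H isT (fun x => ltac:(by case/mapP => k _ ->; exact: fs)).
Qed.

(** Finitely many cells of length [e] cover [[l, r[], and two of the points share a cell. *)
Lemma pigeonhole_dist (R : realType) (l r e : R) (f : nat -> R) : 0 < e ->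
  (forall k, l <= f k < r) -> exists i j, (i < j)%N /\ `|f i - f j| < e.
Proof.
move=> e0 fb; pose g k := Num.truncn ((f k - l) / e).
have fe k : 0 <= (f k - l) / e by apply: divr_ge0; [have := fb k; lra | lra].
have gs k : g k \in iota 0 (Num.truncn ((r - l) / e)).+1.
  rewrite mem_iota /= add0n ltnS; apply: le_truncn.
  by apply: ler_pM => //; [have := fb k; lra|rewrite invr_ge0 ltW|have := fb k; lra].
have [i [j [ij E]]] := pigeonhole_seq gs; exists i, j; split => //.
have /andP[i1 i2] := truncn_itv (fe i).
have /andP[j1 j2] := truncn_itv (fe j).
rewrite -/(g i) in i1 i2; rewrite -/(g j) -E in j1 j2.
rewrite -(mul1r e) -ltr_pdivrMr //.
have -> : `|f i - f j| / e = `|(f i - l) / e - (f j - l) / e|.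
  rewrite -mulrBl normrM [`|e^-1|]gtr0_norm ?invr_gt0 //; congr (`|_| * _); lra.
rewrite -natr1 in i2 j2; rewrite ltr_norml; apply/andP; split; lra.
Qed.

(** * Keane's condition, and Div in terms of linked points *)

Section Regular.
Variables (R : realType) (A : finType).
Implicit Types (T : iet R A) (a b : A) (x y z u v : R).

Definition sep_free T :=
  forall x y n, sep T x -> sep T y -> iter n (iet_map T) x = y -> n = 0%N.

(* [sep_free] is Keane's condition on forward iterates only; it carries all the
   content of regularity, the maps being injective. *)
Lemma iet_regular_sep_free T : iet_regular T -> sep_free T.
Proof.
move=> [inf disj] x y [|n] // [a la ->] [b lb ->] E; exfalso.
case: (eqVneq a b) => [ab|nab].
  rewrite -ab in E; apply: (inf _ la).
  (* If [gamma T a] returns to itself, this finite cycle is stable under [T] and its inverse, so it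
     contains the whole orbit. *)
  pose F := [set iter j (iet_map T) (gamma T a) | j in `I_n.+1].
  have F0 : F (gamma T a) by exists 0%N.
  have Ff z : F z -> F (iet_map T z).
    move=> [j /= jn <-]; case: (ltnP j n) => jn'; first by exists j.+1.
    by have -> : j = n by [lia]; rewrite -iterS E.
  have Fi z : F z -> F (iet_inv T z).
    move=> [[|j] /= jn <-]; last by rewrite iet_mapVK; exists j => //=; exact: ltnW.
    by rewrite -{1}E /= iet_mapVK; exists n => /=.
  apply: (@sub_finite_set _ _ F); last exact/finite_image/finite_II.
  move=> _ [[k|k] _ <-].
    by elim: k => //= k; exact: Ff.
  rewrite /iterz; elim: k.+1 => //= k'; exact: Fi.
move: disj => /(_ a b la lb); apply/not_implyP; split; last exact/eqP.
exists (gamma T b); split; first by exists n.+1%:Z.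
by exists 0%Z.
Qed.

Lemma two_letters T a : (1 < #|A|)%N -> ~ (forall b, b = a).
Proof.
move=> A1 h; have : (#|A| <= 1)%N by apply/card_le1_eqP => x y _ _; rewrite (h x) (h y).
by lia.
Qed.

Lemma delta_left T b : least (le2 T) b -> delta T b = left_end T.
Proof. exact: (@gamma_least _ _ (iet_rev T) b). Qed.

Lemma delta_nleast T b : ~ least (le2 T) b -> left_end T < delta T b.
Proof. exact: (@gamma_nleast _ _ (iet_rev T) b). Qed.

Lemma ex_least2 T : exists b, least (le2 T) b.
Proof.
have [b /andP[b1 _]] : exists b, delta T b <= left_end T < nu T b.
  by apply: (@piece_cover _ _ (iet_rev T)); rewrite iet_domE lexx left_lt_right.
exists b; apply: contrapT => /delta_nleast; by rewrite ltNge b1.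
Qed.

Lemma nu_lt_right T b : (1 < #|A|)%N -> least (le2 T) b -> nu T b < right_end T.
Proof.
move=> A1 lb; have [c cb] : exists c, c != b.
  apply: contrapT => h; apply: (two_letters T (a := b) A1) => c; apply: contrapT => /eqP nc.
  by apply: h; exists c.
have : nu T b <= delta T c.
  apply: (@psum_sep _ _ _ (left_end T) _ (@le2_anti _ _ T) (@le2_trans _ _ T)
    (@le2_total _ _ T) (@len_gt0 _ _ T) b c (lb c)).
  by rewrite eq_sym.
move/le_lt_trans; apply; have := @gamma_dom _ _ (iet_rev T) c.
by rewrite iet_domE => /andP[].
Qed.

Lemma mu_lt_right T a : (1 < #|A|)%N -> least (Defs.le1 T) a -> mu T a < right_end T.
Proof. exact: (@nu_lt_right (iet_rev T)). Qed.

(** If one letter came first in both orders, [T] would fix its piece, and the separation point at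
    the end of that piece would be the image of a separation point. *)
Lemma least_neq T a b : (1 < #|A|)%N -> sep_free T -> least (Defs.le1 T) a ->
  least (le2 T) b -> a != b.
Proof.
move=> A1 reg la lb; apply/eqP => ab; subst b.
have [c Ec] := next_letter (mu_lt_right A1 la).
have [d Ed] := @next_letter _ _ (iet_rev T) a (nu_lt_right A1 lb).
have E : gamma T c = delta T d.
  rewrite Ec; move: Ed; have -> : gamma (iet_rev T) d = delta T d by [].
  have -> : mu (iet_rev T) a = nu T a by [].
  by move=> ->; rewrite -gamma_mu -delta_nu gamma_least // delta_left.
have sc : sep T (gamma T c).
  by apply: gamma_sep; rewrite Ec; exact: le_lt_trans (left_le_gamma T a) (gamma_lt_mu T a).
have sd : sep T (gamma T d).
  exists d => // ld; have da : d = a.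
    by apply: (@le1_anti _ _ T); rewrite ld la.
  move: Ed; have -> : gamma (iet_rev T) d = delta T d by [].
  have -> : mu (iet_rev T) a = nu T a by [].
  by rewrite da -delta_nu; have := len_gt0 T a; lra.
by have := reg _ _ 1%N sd sc; rewrite /= iet_map_gamma E => /(_ erefl).
Qed.

(** The preimage is the left end of the piece whose image comes first. This lets a separation point,
    one step earlier on the orbit, stand in for [left_end T] wherever Keane's condition is
    applied. *)
Lemma left_end_image T : (1 < #|A|)%N -> sep_free T ->
  exists2 g, sep T g & iet_map T g = left_end T.
Proof.
move=> A1 reg; have [b lb] := ex_least2 T; exists (gamma T b).
  by exists b => // la; have := least_neq A1 reg la lb; rewrite eqxx.
by rewrite iet_map_gamma delta_left.
Qed.

Lemma gamma_cases T a : gamma T a = left_end T \/ sep T (gamma T a).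
Proof.
have [la|nl] := pselect (least (Defs.le1 T) a); first by left; exact: gamma_least.
by right; exists a.
Qed.

Lemma ex_gamma_left T : exists a, gamma T a = left_end T.
Proof.
have [b /andP[b1 _]] : exists b, gamma T b <= left_end T < mu T b.
  by apply: piece_cover; rewrite iet_domE lexx left_lt_right.
by exists b; apply/eqP; rewrite eq_le b1 left_le_gamma.
Qed.

(** Trades the two infima in the extended reals for the absence of visits on a finite orbit
    segment. *)
Lemma neighborsP T u v z x :
  neighbors T u v z x <-> arc (iet_map T) (`]u, v[) z x.
Proof.
have Emin n y : iterz T (- n%:Z) y = iter n (iet_inv T) y by case: n.
have iterK n y : iter n (iet_map T) (iter n (iet_inv T) y) = y.
  by elim: n => // n IH; rewrite iterSr [X in iet_map T X]/= iet_mapKV.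
have iterKV n y : iter n (iet_inv T) (iter n (iet_map T) y) = y.
  by elim: n => // n IH; rewrite iterSr [X in iet_inv T X]/= iet_mapVK.
have iterB n j y : (j <= n)%N ->
    iter j (iet_map T) (iter n (iet_inv T) y) = iter (n - j) (iet_inv T) y.
  by move=> jn; rewrite -{1}(subnKC jn) iterD iterK.
have rp (n : nat) : ((n%:Z%:~R)%:E < rho_plus T u v z)%E <->
    forall j, (0 < j <= n)%N -> ~ `]u, v[%classic (iter j (iet_map T) z).
  split=> [h j /andP[j0 jn] O|h].
    have : (rho_plus T u v z <= j%:R%:E)%E by apply: ereal_inf_lbound; exists j.
    by move/(lt_le_trans h); rewrite lte_fin ltr_nat ltnNge jn.
  (* Every visit comes at time [n.+1] or later, so [n.+1] bounds the infimum from below, also when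
     it is [+oo] for lack of visits. *)
  apply: (@lt_le_trans _ _ (n.+1%:R%:E)%E); first by rewrite lte_fin ltr_nat.
  apply: le_ereal_inf_tmp => _ [j [j0 O] <-]; rewrite lee_fin ler_nat ltnNge.
  by apply/negP => jn; apply: (h j) => //; rewrite j0.
have rm (n : nat) : (- rho_minus T u v z <= ((- n%:Z)%:~R)%:E)%E <->
    forall j, (j < n)%N -> ~ `]u, v[%classic (iter j (iet_inv T) z).
  have -> : (- rho_minus T u v z <= ((- n%:Z)%:~R)%:E)%E =
            (n%:R%:E <= rho_minus T u v z)%E.
    by rewrite leeNl -EFinN mulrNz opprK.
  split=> [h j jn O|h].
    have : (rho_minus T u v z <= j%:R%:E)%E.
      by apply: ereal_inf_lbound; exists j => //=; rewrite Emin.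
    by move/(le_trans h); rewrite lee_fin ler_nat leqNgt jn.
  apply: le_ereal_inf_tmp => _ [j O <-]; rewrite lee_fin ler_nat leqNgt.
  by apply/negP => jn; apply: (h j jn); rewrite -Emin.
have rm0 (n : nat) : (- rho_minus T u v z <= (n%:Z%:~R)%:E)%E.
  apply: (@le_trans _ _ ((- 0%N%:Z)%:~R)%:E); first exact/rm.
  by rewrite lee_fin oppr0 ler_int.
have rp0 (n : nat) : (((- n%:Z)%:~R)%:E < rho_plus T u v z)%E.
  apply: (@le_lt_trans _ _ (0%N%:Z%:~R)%:E); last by apply/rp => j; lia.
  by rewrite lee_fin ler_int; lia.
split.
  move=> [k /andP[k1 k2] <-]; have [n [E|E]] : exists n : nat, k = n%:Z \/ k = - n%:Z.
    by exists `|k|%N; lia.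
  - by left; exists n; [rewrite E | apply/rp; rewrite -E].
  - right; exists n; rewrite E Emin ?iterK // => j /andP[j0 jn].
    by rewrite iterB //; move: k1; rewrite E => /rm; apply; lia.
move=> [[n -> h]|[n E h]].
  by exists n%:Z => //; apply/andP; split => //; exact/rp.
exists (- n%:Z); last by rewrite Emin E iterKV.
apply/andP; split => //; apply/rm => j jn; rewrite E.
have -> : iter j (iet_inv T) (iter n (iet_map T) x) = iter (n - j) (iet_map T) x.
  by rewrite -{1}(subnKC (ltnW jn)) iterD iterKV.
by apply: h; lia.
Qed.

(* [left_end T] contributes nothing to Div: it is the image of a separation
   point and lies outside ]u, v[. *)
Lemma DivP T u v x : (1 < #|A|)%N -> sep_free T -> left_end T <= u ->
  Div T u v x <-> exists2 g, sep T g & arc (iet_map T) (`]u, v[) x g.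
Proof.
move=> A1 reg lu; split.
  move=> [a _ /neighborsP ax]; have xa := arc_sym ax.
  case: (gamma_cases T a) => [ga|sa]; last by exists (gamma T a).
  have [g sg Eg] := left_end_image A1 reg; exists g => //.
  apply: (arc_trans (@iet_map_inj _ _ T) xa); right; rewrite ga -Eg.
  by apply: fwd_step; rewrite Eg /= in_itv /= ltNge lu.
by move=> [_ [a _ ->] h]; exists a => //; apply/neighborsP/arc_sym.
Qed.

End Regular.

(** * Translation of cells up to the first return *)

Section SeqGaps.
Variable R : realType.
Implicit Types (s : seq R) (x y b c : R).

Lemma seq_gap_right s x b : x < b ->
  exists2 y, x < y < b & forall c, c \in s -> ~ x < c <= y.
Proof.
move=> xb; elim: s => [|d s [y /andP[xy yb] h]].
  by exists ((x + b) / 2) => //; apply/andP; split; lra.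
have [/andP[xd dy]|nd] := boolP (x < d <= y).
  exists ((x + d) / 2); first by apply/andP; split; lra.
  move=> c; rewrite inE => /orP[/eqP ->|cs] /andP[c1 c2]; first lra.
  by apply: (h c cs); apply/andP; split; lra.
exists y; first by rewrite xy yb.
by move=> c; rewrite inE => /orP[/eqP ->|/h//]; exact/negP.
Qed.

Lemma seq_gap_left s x b : b < x ->
  exists2 y, b < y < x & forall c, c \in s -> ~ y <= c < x.
Proof.
move=> bx; have bx' : - x < - b by rewrite ltrN2.
have [y /andP[xy yb] h] := seq_gap_right (map -%R s) bx'.
exists (- y); first by apply/andP; split; lra.
move=> c cs /andP[c1 c2]; apply: (h (- c)); first exact: map_f.
by apply/andP; split; lra.
Qed.

Lemma seq_pred s x p : p \in s -> p <= x ->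
  exists c, [/\ c \in s, c <= x & forall d, d \in s -> ~ c < d <= x].
Proof.
move=> ps px.
have : forall s', {subset s' <= s} -> exists c,
    [/\ c \in s, c <= x & forall d, d \in s' -> ~ c < d <= x].
  elim=> [|e s' IH] ss; first by exists p.
  have [|c [cs cx h]] := IH; first by move=> d ds; apply: ss; rewrite inE ds orbT.
  have [/andP[ce ex]|ne] := boolP (c < e <= x).
    exists e; split => //; first by apply: ss; rewrite mem_head.
    move=> d; rewrite inE => /orP[/eqP ->|ds] /andP[d1 d2]; first lra.
    by apply: (h d ds); apply/andP; split; lra.
  exists c; split => // d; rewrite inE => /orP[/eqP ->|/h//]; exact/negP.
by apply.
Qed.

End SeqGaps.

Lemma in_ooE (R : realType) (p q x : R) :
  `]p, q[%classic x = (p < x < q) :> Prop.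
Proof. by rewrite /= in_itv. Qed.

Section Tower.
Variables (R : realType) (A : finType) (T : iet R A) (p q : R) (P : set R).
Local Notation f := (iet_map T).
Local Notation O := (`]p, q[%classic).
Implicit Types (x y w c g : R).

(** The last visit to []p, q[] before a point of [P]. [P] is a parameter since the tower is built
    twice: over the separation points, and over these together with [p] and [q]. *)
Definition cut c := p < c < q /\ exists2 g, P g & fwd f O c g.

Lemma cut_arc w k g : p < w < q ->
  (forall j, (0 < j <= k)%N -> ~ O (iter j f w)) ->
  P g -> arc f O (iter k f w) g -> cut w.
Proof.
move=> wO h Pg hg; split => //; exists g => //; apply: arc_fwd.
  by rewrite in_ooE.
by apply: (arc_trans (@iet_map_inj _ _ T)) hg; left; exists k.
Qed.

(** Each point of [P] has at most one last visit to []p, q[]. *)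
Lemma cut_finite (s : seq R) : (forall g, P g -> g \in s) ->
  exists s' : seq R, forall c, cut c -> c \in s'.
Proof.
move=> Ps; suff [s' h] : exists s' : seq R, forall c g, g \in s -> p < c < q ->
    fwd f O c g -> c \in s'.
  by exists s' => c [cO [g /Ps gs hc]]; exact: h hc.
elim: {Ps} s => [|g s [s' h]]; first by exists [::].
have [[c0 [c0O hc0]]|nc] := pselect (exists c, p < c < q /\ fwd f O c g).
  exists (c0 :: s') => c g'; rewrite !inE => /orP[/eqP ->|gs] cO hc.
    by rewrite (fwd_last_uniq (@iet_map_inj _ _ T) _ _ hc hc0) ?eqxx ?in_ooE.
  by rewrite (h c g') ?orbT.
exists s' => c g'; rewrite inE => /orP[/eqP ->|gs] cO hc; last exact: h hc.
by exfalso; apply: nc; exists c.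
Qed.

Hypotheses (lp : left_end T <= p) (qr : q <= right_end T).
Hypothesis sepP : forall g, sep T g -> P g.
Hypothesis pP : p = left_end T \/ exists2 g, P g & arc f O p g.
Hypothesis qP : q = right_end T \/ exists2 g, P g & arc f O q g.

Lemma sub_dom x : p <= x < q -> iet_dom T x.
Proof. by rewrite iet_domE => xJ; move: lp qr xJ; lra. Qed.

Section Cell.
Variables (x y : R) (n : nat).
Hypotheses (px : p <= x) (xy : x <= y) (yq : y < q).
Hypothesis nocut : forall c, cut c -> ~ x < c <= y.
Hypothesis noret : forall k, (0 < k < n)%N -> ~ p <= iter k f x < q.

(** The first accident in the motion of [[x, y]] would be a separation point inside its image, or an
    image that enters [[p, q[] while that of [x] is still outside. In the second case the image of
    [x] lies to the left of [p], so [p] is covered. Either way some point of []x, y]] is sent to a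
    point linked to [P] without an intermediate visit, and so is a cut. The three clauses feed each
    other and need a joint induction. *)
Lemma tower k : (k <= n)%N ->
  [/\ forall w, x <= w <= y -> iter k f w = iter k f x + (w - x),
      (0 < k < n)%N -> forall w, x <= w <= y -> ~ p <= iter k f w < q &
      (k < n)%N -> exists a, gamma T a <= iter k f x /\ iter k f y < mu T a].
Proof.
move: (lp) (qr) (px) (xy) (yq) => lp' qr' px' xy' yq'.
elim/ltn_ind: k => k IH kn.
have tr w : x <= w <= y -> iter k f w = iter k f x + (w - x).
  case: k kn IH => [|k] kn IH /andP[xw wy]; first by rewrite /=; lra.
  have [tr _ /(_ kn) [a [xa ya]]] := IH k (ltnSn k) (ltnW kn).
  have Ew := tr w ltac:(by rewrite xw wy).
  have Ey := tr y ltac:(by rewrite xy lexx).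
  rewrite /= (@iet_mapE _ _ T a (iter k f w)); last by apply/andP; split; lra.
  by rewrite (@iet_mapE _ _ T a (iter k f x)); [lra | apply/andP; split; lra].
have xT : iet_dom T (iter k f x) by apply: iter_dom; apply: sub_dom; apply/andP; split; lra.
have yT : iet_dom T (iter k f y) by apply: iter_dom; apply: sub_dom; apply/andP; split; lra.
have Ey := tr y ltac:(by rewrite xy lexx).
have pos z : iter k f x < z <= iter k f y ->
    exists2 w, x < w <= y & iter k f w = z.
  move=> /andP[z1 z2]; exists (x + (z - iter k f x)); first by apply/andP; split; lra.
  by rewrite tr; [lra | apply/andP; split; lra].
have nr : (0 < k < n)%N -> forall w, x <= w <= y -> ~ p <= iter k f w < q.
  move=> /andP[k0 kn'] w wb /andP[pw wq].
  have xp : iter k f x < p.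
    rewrite ltNge; apply/negP => h; apply: (@noret k); first by rewrite k0.
    by rewrite h /=; have := tr w wb; move: wb; lra.
  have [w' w'b Ew'] : exists2 w', x < w' <= y & iter k f w' = p.
    by apply: pos; rewrite xp /= (le_trans pw) // tr // Ey; move: wb; lra.
  case: pP => [pl|[g Pg hg]]; first by move: xT; rewrite iet_domE; lra.
  apply: (nocut _ w'b); apply: (@cut_arc w' k g) => //; last by rewrite Ew'.
    by apply/andP; move: w'b; lra.
  move=> j /andP[j0 jk]; case: (ltnP j k) => jk'.
    have [_ h _] := IH j jk' (leq_trans jk kn); rewrite in_ooE => /andP[h1 h2].
    apply: (h _ w'); first by rewrite j0 (leq_trans jk' kn).
      by move: w'b => /andP[/ltW -> ->].
    by rewrite h2 ltW.
  have -> : j = k by apply/eqP; rewrite eqn_leq jk.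
  by rewrite Ew' in_ooE ltxx.
split=> // kn'; apply: same_piece => //; first by rewrite Ey; lra.
move=> s /sepP Ps /pos[w wb Ew].
apply: (nocut _ wb); apply: (@cut_arc w k s) => //; last by rewrite Ew; left; exact: fwd_refl.
  by apply/andP; move: wb; lra.
move=> j /andP[j0 jk]; rewrite in_ooE => /andP[h1 h2].
have wb' : x <= w <= y by move: wb; lra.
have wJ : p <= iter j f w < q by rewrite h2 ltW.
case: (ltnP j k) => jk'.
  have [_ h _] := IH j jk' (leq_trans jk kn).
  by apply: (h _ w) => //; rewrite j0 (leq_trans jk' kn).
have Ej : j = k by apply/eqP; rewrite eqn_leq jk.
by rewrite Ej in wJ j0; apply: (nr _ w) => //; rewrite j0.
Qed.

(** When [x] returns, the block could leave [[p, q[] only across [q]; the point sent to [q] would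
    then be a cut, [q] being linked to [P]. *)
Lemma tower_return w : (0 < n)%N -> p <= iter n f x < q -> x <= w <= y ->
  p <= iter n f w < q.
Proof.
move: (lp) (qr) (px) (xy) (yq) => lp' qr' px' xy' yq'.
move=> n0 /andP[pn nq] wb; have [tr _ _] := tower (leqnn n).
have Ew := tr w wb; apply/andP; split; first by move: wb; lra.
rewrite ltNge; apply/negP => qw.
pose w' := x + (q - iter n f x).
have w'b : x < w' <= y by rewrite /w'; move: wb; lra.
have Ew' : iter n f w' = q by rewrite tr; [rewrite /w'; lra | move: w'b; lra].
case: qP => [qE|[g Pg hg]].
  have : iet_dom T (iter n f w) by apply: iter_dom; apply: sub_dom; move: wb; lra.
  by rewrite iet_domE; lra.
apply: (nocut _ w'b); apply: (@cut_arc w' n g) => //; last by rewrite Ew'.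
  by apply/andP; move: w'b; lra.
move=> j /andP[j0 jn]; rewrite in_ooE => /andP[h1 h2]; case: (ltnP j n) => jn'.
  have [_ h _] := tower (ltnW jn'); apply: (h _ w'); first by rewrite j0.
    by move: w'b; lra.
  by rewrite h2 ltW.
have Ej : j = n by apply/eqP; rewrite eqn_leq jn.
by move: h2; rewrite Ej Ew' ltxx.
Qed.

End Cell.
End Tower.

(** * Recurrence and bounded return times in arbitrary semi-intervals *)

Section Recurrence.
Variables (R : realType) (A : finType).
Implicit Types (T : iet R A) (p q x y : R).

Definition sep_seq T := [seq gamma T a | a <- enum A].

Lemma sep_seqP T g : sep T g -> g \in sep_seq T.
Proof. by move=> [a _ ->]; apply: map_f; rewrite mem_enum. Qed.

Section Interval.
Variables (T : iet R A) (p q : R).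
Local Notation f := (iet_map T).
(** With [p] and [q] in [P] the end point hypotheses of the tower hold trivially. *)
Let P : set R := [set g | g \in [:: p, q & sep_seq T]].
Hypotheses (lp : left_end T <= p) (qr : q <= right_end T).

Let sepP g : sep T g -> P g.
Proof. by move=> /sep_seqP gs; rewrite /P/= !inE gs !orbT. Qed.
Let pP : p = left_end T \/ exists2 g, P g & arc f (`]p, q[%classic) p g.
Proof. by right; exists p; [rewrite /P/= mem_head|left; exact: fwd_refl]. Qed.
Let qP : q = right_end T \/ exists2 g, P g & arc f (`]p, q[%classic) q g.
Proof. by right; exists q; [rewrite /P/= !inE eqxx orbT|left; exact: fwd_refl]. Qed.

(** A cell that never returned would be translated forever. Two of its images, of equal length in a
    bounded interval, overlap, and injectivity turns the overlap into a return of a point of the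
    cell. *)
Lemma recurrence x : p <= x < q -> exists n, (0 < n)%N && (p <= iter n f x < q).
Proof.
move=> /andP[px xq]; apply: contrapT => nret.
have {}nret k : (0 < k)%N -> ~ p <= iter k f x < q.
  by move=> k0 h; apply: nret; exists k; rewrite k0.
have [s hs] := cut_finite T p q (P := P) (fun g h => h).
have [y /andP[xy yq] hy] := seq_gap_right s xq.
have nc c : cut T p q P c -> ~ x < c <= y by move=> /hs /hy.
have tw n := tower lp qr sepP pP px (ltW xy) yq nc (n := n)
  (fun k h => nret k ltac:(by case/andP: h)).
have tr n w : x <= w <= y -> iter n f w = iter n f x + (w - x).
  by move=> wb; have [h _ _] := tw n n (leqnn n); exact: h.
have nr n w : (0 < n)%N -> x <= w <= y -> ~ p <= iter n f w < q.
  move=> n0 wb; have [_ h _] := tw n.+1 n (leqnSn n).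
  by apply: h => //; rewrite n0 ltnSn.
have fb k : left_end T <= iter k f x < right_end T.
  rewrite -iet_domE; apply: iter_dom; apply: (sub_dom lp qr).
  by rewrite px.
have [i [j [ij]]] := pigeonhole_dist (e := y - x) ltac:(lra) fb.
rewrite ltr_norml => /andP[d1 d2].
have [le_ij|lt_ji] := lerP (iter i f x) (iter j f x).
  pose w := x + (iter j f x - iter i f x).
  have wb : x <= w <= y by rewrite /w; apply/andP; split; lra.
  have E : iter i f w = iter j f x by rewrite tr // /w; lra.
  have E2 : w = iter (j - i) f x.
    apply: (@iter_inj _ f (@iet_map_inj _ _ T) i).
    by rewrite E -iterD subnKC // ltnW.
  by apply: (nret (j - i)%N); [rewrite subn_gt0|rewrite -E2; lra].
pose w := x + (iter i f x - iter j f x).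
have wb : x <= w <= y by rewrite /w; apply/andP; split; lra.
have E : iter j f w = iter i f x by rewrite tr // /w; lra.
have E2 : iter (j - i) f w = x.
  apply: (@iter_inj _ f (@iet_map_inj _ _ T) i).
  by rewrite -E -iterD subnKC // ltnW.
by apply: (nr (j - i)%N w) => //; [rewrite subn_gt0|rewrite E2 px].
Qed.

Lemma first_return x : p <= x < q -> exists n, [/\ (0 < n)%N,
  p <= iter n f x < q & forall k, (0 < k < n)%N -> ~ p <= iter k f x < q].
Proof.
move=> xJ; case: (ex_minnP (recurrence xJ)) => n /andP[n0 nJ] nmin.
exists n; split => // k /andP[k0 kn] kJ.
by have := nmin k; rewrite k0 kJ => /(_ isT); rewrite leqNgt kn.
Qed.

(** The points of a cell come back at the return time of its left end, and there are finitely many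
    cells. [p] is adjoined to the cuts as the left end of the first cell. *)
Lemma bounded_return : exists N, forall x, p <= x < q ->
  exists2 n, (0 < n <= N)%N & p <= iter n f x < q.
Proof.
have [s hs] := cut_finite T p q (P := P) (fun g h => h).
have [N hN] : exists N, forall c, c \in p :: s -> p <= c < q ->
    exists n, [/\ (0 < n <= N)%N, p <= iter n f c < q &
      forall k, (0 < k < n)%N -> ~ p <= iter k f c < q].
  elim: (p :: s) => [|d s' [N IH]]; first by exists 0%N.
  have [dJ|ndJ] := pselect (p <= d < q).
    have [n [n0 nJ nmin]] := first_return dJ.
    exists (maxn n N) => c; rewrite inE => /orP[/eqP ->|cs] cJ.
      by exists n; rewrite n0 leq_maxl.
    have [m [/andP[m1 mN] m2 m3]] := IH c cs cJ; exists m; split => //.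
    by rewrite m1 (leq_trans mN) ?leq_maxr.
  exists N => c; rewrite inE => /orP[/eqP -> //|cs]; exact: IH.
exists N => x /andP[px xq].
have [c [cs cx hc]] := seq_pred (mem_head p s) px.
have cp : p <= c.
  by rewrite leNgt; apply/negP => cp; apply: (hc p); rewrite ?mem_head// cp px.
have [n [n1 n2 n3]] := hN c cs ltac:(by rewrite cp (le_lt_trans cx)).
exists n => //; apply: (tower_return lp qr sepP pP qP cp cx xq _ n3 _ n2).
- by move=> d /hs ds; apply: hc; rewrite inE ds orbT.
- by case/andP: n1.
- by rewrite cx lexx.
Qed.

End Interval.
End Recurrence.

(** * Minimality *)

Section Minimality.
Variables (R : realType) (A : finType).
Implicit Types (T : iet R A) (p q x y z : R) (V : R -> Prop).

Lemma translate T x y n : iet_dom T x -> iet_dom T y -> x <= y ->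
  (forall w k, (k < n)%N -> x < w <= y -> ~ sep T (iter k (iet_map T) w)) ->
  forall k, (k <= n)%N -> forall w, x <= w <= y ->
    iter k (iet_map T) w = iter k (iet_map T) x + (w - x).
Proof.
move=> xT yT xy ns; elim=> [|k IH] kn w wb; first by rewrite /=; lra.
have {}IH := IH (ltnW kn).
have Ey := IH y ltac:(by rewrite xy lexx).
have Ew := IH w wb.
have [||||a [xa ya]] := @same_piece _ _ T (iter k (iet_map T) x) (iter k (iet_map T) y).
- exact: iter_dom.
- exact: iter_dom.
- by rewrite Ey; lra.
- move=> s ss sb; pose w' := x + (s - iter k (iet_map T) x).
  have w'b : x < w' <= y by rewrite /w'; lra.
  apply: (ns w' k kn w'b).
  by rewrite IH; [have -> : iter k (iet_map T) x + (w' - x) = s by rewrite /w'; lra | lra].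
rewrite /= (@iet_mapE _ _ T a (iter k (iet_map T) w)); last by move: wb; lra.
by rewrite (@iet_mapE _ _ T a (iter k (iet_map T) x)); [lra|move: wb; lra].
Qed.

Lemma ex_argmin_nat (n : nat) (g : nat -> R) : (0 < n)%N ->
  exists2 k, (k < n)%N & forall j, (j < n)%N -> g k <= g j.
Proof.
elim: n => // -[|n] IH _; first by exists 0%N => // j; rewrite ltnS leqn0 => /eqP ->.
have [//|k kn h] := IH; case: (lerP (g k) (g n.+1)) => hk.
  exists k; first exact: ltnW.
  move=> j; rewrite ltnS leq_eqVlt => /orP[/eqP ->//|/h//].
exists n.+1 => // j; rewrite ltnS leq_eqVlt => /orP[/eqP ->//|/h].
exact/le_trans/ltW.
Qed.

(* Sliding a periodic orbit to the left until it meets some [gamma T a] keeps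
   it periodic, since T translates the pieces rigidly. *)
Lemma no_periodic T n x : (1 < #|A|)%N -> sep_free T -> iet_dom T x ->
  (0 < n)%N -> iter n (iet_map T) x <> x.
Proof.
move=> A1 reg xT n0 per.
have [g hg] := choice (fun k => piece_cover (iter_dom k xT)).
(* The least distance from a point of the cycle to the left end of its piece: sliding by it keeps
   every point in its piece. *)
have [k kn kmin] := ex_argmin_nat (fun k => iter k (iet_map T) x - gamma T (g k)) n0.
pose e := iter k (iet_map T) x - gamma T (g k).
have e0 : 0 <= e by rewrite /e; have := hg k; lra.
have tr j : (j <= n)%N -> iter j (iet_map T) (x - e) = iter j (iet_map T) x - e.
  elim: j => // j IH jn; have := kmin j jn; have := hg j; rewrite -/e => hj ej.
  rewrite /= (IH (ltnW jn)) (@iet_mapE _ _ T (g j)); last by move: hj ej e0; lra.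
  by rewrite (@iet_mapE _ _ T (g j) _ hj); lra.
have per' : iter n (iet_map T) (gamma T (g k)) = gamma T (g k).
  have <- : iter k (iet_map T) (x - e) = gamma T (g k) by rewrite tr ?(ltnW kn)// /e; lra.
  by rewrite -iterD addnC iterD tr // per.
have [gl|sg] := gamma_cases T (g k).
  have [h sh Eh] := left_end_image A1 reg.
  have : iter n (iet_map T) h = h.
    by apply: (@iet_map_inj _ _ T); rewrite -iterS iterSr Eh -gl.
  by move/(reg _ _ _ sh sh) => n0'; rewrite n0' in n0.
by have := reg _ _ _ sg sg per' => n0'; rewrite n0' in n0.
Qed.

Section Boundary.
Variables (T : iet R A) (V : R -> Prop).
Hypothesis VT : forall z, V (iet_map T z) <-> V z.

(** [V] is a finite union of semi-intervals inside the domain, with end points in [D] or at the ends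
    of the domain; a point of [D] belongs to the cell on its right. *)
Definition adapted (D : seq R) := forall x y, iet_dom T x -> iet_dom T y ->
  x < y -> (forall d, d \in D -> ~ x < d <= y) -> (V x <-> V y).

(** Only jumps seen from the left count, since the cells of an adapted [D] are closed on the
    left. *)
Definition boundary x := left_end T < x < right_end T /\
  forall e, e < x -> exists2 y, iet_dom T y /\ e < y < x & ~ (V y <-> V x).

Lemma boundary_adapted D x : adapted D -> boundary x -> x \in D.
Proof.
move=> ad [xT h]; apply: contrapT => xD.
have [e /andP[le ex] he] := @seq_gap_left _ D x (left_end T) ltac:(by case/andP: xT).
have [y [yT /andP[ey yx]]] := h e ex; apply; apply: ad => //.
  by rewrite iet_domE; lra.
move=> d dD /andP[d1]; rewrite le_eqVlt => /orP[/eqP dx|d2].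
  by apply: xD; rewrite -dx.
by apply: (he d dD); apply/andP; split; lra.
Qed.

Lemma adapted_drop d D : adapted (d :: D) -> ~ boundary d -> adapted D.
Proof.
move=> ad nb x y; rewrite !iet_domE => xT yT xy h.
have [/andP[xd dy]|nd] := pselect (x < d <= y); last first.
  apply: ad; rewrite ?iet_domE// => c; rewrite inE => /orP[/eqP -> //|/h //].
have dT : iet_dom T d by rewrite iet_domE; lra.
have Vdy : V d <-> V y.
  move: dy; rewrite le_eqVlt => /orP[/eqP <- //|dy].
  apply: ad => //; rewrite ?iet_domE//.
  move=> c; rewrite inE => /orP[/eqP ->|/h hc] cb; first lra.
  by apply: hc; lra.
have [e ed he] : exists2 e, e < d & forall y', iet_dom T y' -> e < y' < d -> V y' <-> V d.
  apply: contrapT => hn; apply: nb; split; first lra.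
  move=> e ed; apply: contrapT => hn'; apply: hn; exists e => // y' y'T y'e.
  by apply: contrapT => hV; apply: hn'; exists y'.
pose m := Num.max e x; have md : m < d by rewrite /m gt_max ed.
have em : e <= m by rewrite /m le_max lexx.
have xm : x <= m by rewrite /m le_max lexx orbT.
pose y' := (m + d) / 2.
have y'b : m < y' < d by rewrite /y'; lra.
have y'T : iet_dom T y' by rewrite iet_domE; lra.
rewrite -Vdy -(he y') //; last lra.
apply: ad => //; rewrite ?iet_domE//; first lra.
move=> c; rewrite inE => /orP[/eqP ->|/h hc] cb; first lra.
by apply: hc; lra.
Qed.

Lemma no_boundary_const D : adapted D -> (forall x, ~ boundary x) -> adapted [::].
Proof.
by elim: D => // d D IH ad nb; apply: IH => //; apply: (adapted_drop ad); exact: nb.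
Qed.

(** Away from separation points [T] is a translation on a left neighbourhood, and it preserves
    [V]. *)
Lemma boundary_map x : boundary x -> ~ sep T x -> boundary (iet_map T x).
Proof.
move=> [xT h] ns.
have [a /andP[ax xa]] : exists a, gamma T a <= x < mu T a.
  by apply: piece_cover; rewrite iet_domE; lra.
have {}ax : gamma T a < x.
  rewrite lt_neqAle ax andbT; apply/eqP => E; apply: ns; rewrite -E.
  by apply: gamma_sep; rewrite E; lra.
have Ex : iet_map T x = x + (delta T a - gamma T a) by apply: iet_mapE; lra.
have la : left_end T <= delta T a by exact: (@left_le_gamma _ _ (iet_rev T) a).
have ar : nu T a <= right_end T by exact: (@mu_le_right _ _ (iet_rev T) a).
have E1 := gamma_mu T a; have E2 := delta_nu T a.
split; first by rewrite Ex; lra.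
move=> e ex; have [|y [yT ye] nV] := h (Num.max (gamma T a) (e - (delta T a - gamma T a))).
  by rewrite gt_max ax /=; lra.
move: ye; rewrite gt_max => /andP[/andP[ay ey] yx].
have Ey : iet_map T y = y + (delta T a - gamma T a) by apply: iet_mapE; lra.
exists (iet_map T y); last by rewrite !VT.
by split; [exact: iet_map_dom | rewrite Ey Ex; lra].
Qed.

(** The boundary is finite. An orbit that avoids the separation points would stay in it and hence be
    periodic. *)
Lemma boundary_hits_sep D x : adapted D -> boundary x ->
  (forall n y, iet_dom T y -> (0 < n)%N -> iter n (iet_map T) y <> y) ->
  exists n, sep T (iter n (iet_map T) x).
Proof.
move=> ad bx np; apply: contrapT => ns.
have bn n : boundary (iter n (iet_map T) x).
  elim: n => // n IH; apply: boundary_map => // s; apply: ns; by exists n.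
have [i [j [ij E]]] := pigeonhole_seq (fun k => boundary_adapted ad (bn k)).
apply: (np (j - i)%N x); last exact: (iter_eq_periodic (@iet_map_inj _ _ T)).
  by case: bx => xT _; rewrite iet_domE; lra.
by rewrite subn_gt0.
Qed.

End Boundary.

Lemma iter_mapKV T n z : iter n (iet_map T) (iter n (iet_inv T) z) = z.
Proof. by elim: n => // n IH; rewrite iterSr [X in iet_map T X]/= iet_mapKV. Qed.

Lemma iter_mapVK T n z : iter n (iet_inv T) (iter n (iet_map T) z) = z.
Proof. exact: (@iter_mapKV (iet_rev T)). Qed.

Lemma iter_invB T n k z : (k <= n)%N ->
  iter n (iet_inv T) (iter k (iet_map T) z) = iter (n - k) (iet_inv T) z.
Proof. by move=> kn; rewrite -{1}(subnK kn) iterD iter_mapVK. Qed.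

Section Saturation.
Variables (T : iet R A) (p q : R).
Hypotheses (lp : left_end T <= p) (qr : q <= right_end T) (pq : p < q).
Local Notation f := (iet_map T).

Definition saturated z := exists n, p <= iter n f z < q.

Lemma saturated_map z : saturated (f z) <-> saturated z.
Proof.
split=> [[n nJ]|[[|n] nJ]]; first by exists n.+1; rewrite iterSr.
  (* A visit at time 0 is lost when passing to [f z]; recurrence supplies a later one. *)
  have [[|m] // mJ] := recurrence lp qr nJ.
  by exists m; rewrite -iterSr.
by exists n; rewrite -iterSr.
Qed.

Lemma recurrence_rev x : p <= x < q ->
  exists n, (0 < n)%N && (p <= iter n (iet_inv T) x < q).
Proof. exact: (@recurrence _ _ (iet_rev T)). Qed.

Lemma recurrence_rev_far x m : p <= x < q ->
  exists2 n, (m <= n)%N & p <= iter n (iet_inv T) x < q.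
Proof.
move=> xJ; elim: m => [|m [n mn nJ]]; first by exists 0%N.
have [k /andP[k0 kJ]] := recurrence_rev nJ.
by exists (k + n)%N; [rewrite -add1n leq_add|rewrite iterD].
Qed.

(** Backward recurrence, started from a visit, finds a visit at or before [z]. From there on the
    gaps between visits are bounded, so one visit falls shortly after [z]. *)
Lemma saturated_bounded : exists N, forall z, saturated z ->
  exists2 n, (n <= N)%N & p <= iter n f z < q.
Proof.
have [N hN] := bounded_return lp qr; exists N => z [k kJ].
have [n kn] := recurrence_rev_far k kJ; rewrite (iter_invB _ _ kn) => wJ.
have visits m : exists2 i, (i <= N)%N & p <= iter (m + i) f (iter (n - k) (iet_inv T) z) < q.
  elim: m => [|m [[|i] iN iJ]]; first by exists 0%N.
    rewrite addn0 in iJ; have [[|i] // iN' i'J] := hN _ iJ.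
    exists i; first exact: ltnW.
    by rewrite -iterD addSnnS addnC in i'J.
  by exists i; [exact: ltnW|rewrite addSnnS].
have [i iN iJ] := visits (n - k)%N; exists i => //.
by rewrite addnC iterD iter_mapKV in iJ.
Qed.

(** As waiting times are at most [N], only the preimages of [p], [q] and the separation points up to
    order [N] matter: between them, points travel in parallel and visit together. *)
Lemma saturated_adapted : exists D, adapted T saturated D.
Proof.
have [N hN] := saturated_bounded.
exists [seq iter k (iet_inv T) d | k <- iota 0 N.+1, d <- p :: q :: sep_seq T].
move=> x y xT yT xy h.
have {}h w k d : (k < N.+1)%N -> x < w <= y -> d \in p :: q :: sep_seq T ->
    iter k f w <> d.
  move=> kN wb dP E; apply: (h w) => //; rewrite -(iter_mapVK T k w) E.
  by apply/allpairsP; exists (k, d); rewrite mem_iota.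
have tr k w : (k < N.+1)%N -> x <= w <= y -> iter k f w = iter k f x + (w - x).
  move=> kN; apply: (@translate T x y N.+1) => //; [exact: ltW| |exact: ltnW].
  move=> w' k' kN' wb' /sep_seqP ss; apply: (h w' k' (iter k' f w')) => //.
  by rewrite !inE ss !orbT.
have nd k d : (k < N.+1)%N -> d \in p :: q :: sep_seq T -> ~ iter k f x < d <= iter k f y.
  move=> kN dP; rewrite (tr k y kN) ?(ltW xy) ?lexx// => db.
  pose w' := x + (d - iter k f x); have w'b : x < w' <= y by rewrite /w'; lra.
  apply: (h w' k d kN w'b dP).
  by rewrite tr // /w'; lra.
have xyk k : (k < N.+1)%N -> iter k f x < iter k f y.
  by move=> kN; rewrite (tr k y kN) ?(ltW xy) ?lexx//; lra.
have nJ' n : (n < N.+1)%N -> (p <= iter n f x < q) <-> (p <= iter n f y < q).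
  move=> nN; have xn := xyk n nN.
  have /negP np := nd n p nN (mem_head _ _).
  have /negP nq : ~ iter n f x < q <= iter n f y by apply: nd; rewrite // !inE eqxx orbT.
  by split=> nJ; move: np nq; rewrite !negb_and -!leNgt -!ltNge; lra.
by split=> /hN[n nN nJ]; exists n; apply/nJ'.
Qed.

(** The core of Keane's theorem. The orbit of a boundary point meets a separation point in the
    future and, in the past, one of the inverse, that is, the image [delta T b] of some [gamma T b].
    This contradicts Keane's condition, so there is no boundary and the saturation of [[p, q[] is
    everything. *)
Lemma saturated_all z : (1 < #|A|)%N -> sep_free T -> iet_dom T z -> saturated z.
Proof.
move=> A1 reg zT; have np n y := @no_periodic T n y A1 reg.
have [D ad] := saturated_adapted.
have nb x : ~ boundary T saturated x.
  move=> bx.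
  have [n sn] := boundary_hits_sep saturated_map ad bx np.
  have [m sm] : exists m, sep (iet_rev T) (iter m (iet_inv T) x).
    apply: (@boundary_hits_sep (iet_rev T) saturated _ D) => //.
      by move=> y; rewrite iet_map_rev -saturated_map iet_mapKV.
    move=> k y yT k0; rewrite iet_map_rev => E; apply: (np k y yT k0).
    by rewrite -{1}E iter_mapKV.
  have [b nlb Eb] := sm.
  (* The step from [gamma T b] to [delta T b] keeps the exponent positive even when [n] and [m]
     vanish. *)
  have Em : iter (n + m).+1 f (gamma T b) = iter n f x.
    rewrite iterSr iet_map_gamma -[delta T b]/(gamma (iet_rev T) b) -Eb.
    by rewrite iterD iter_mapKV.
  have [gl|sg] := gamma_cases T b; last by have := reg _ _ _ sg sn Em.
  have [h sh Eh] := left_end_image A1 reg.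
  have Em' : iter (n + m).+2 f h = iter n f x by rewrite iterSr Eh -gl.
  by have := reg _ _ _ sh sn Em'.
have ad0 := no_boundary_const ad nb.
have pV : saturated p by exists 0%N; rewrite lexx.
have pT : iet_dom T p by rewrite iet_domE; move: lp qr pq; lra.
have [zp|pz|->//] := ltgtP z p.
  by apply/(ad0 z p).
by apply/(ad0 p z).
Qed.

End Saturation.

Lemma minimal_forward T p q z : (1 < #|A|)%N -> sep_free T ->
  left_end T <= p -> q <= right_end T -> p < q -> iet_dom T z ->
  exists2 n, (0 < n)%N & p < iter n (iet_map T) z < q.
Proof.
move=> A1 reg lp qr pq zT.
(* A visit to the right half, a semi-interval, is a visit to the open interval. *)
have lm : left_end T <= (p + q) / 2 by lra.
have mq : (p + q) / 2 < q by lra.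
have [n nJ] := saturated_all lm qr mq A1 reg (iet_map_dom zT).
by exists n.+1 => //; rewrite iterSr; lra.
Qed.

Lemma minimal_backward T p q z : (1 < #|A|)%N -> sep_free T ->
  left_end T <= p -> q <= right_end T -> p < q -> iet_dom T z ->
  exists w n, p < w < q /\ z = iter n (iet_map T) w.
Proof.
move=> A1 reg lp qr pq zT.
have lm : left_end T <= (p + q) / 2 by lra.
have mq : (p + q) / 2 < q by lra.
have [n nJ] := saturated_all lm qr mq A1 reg zT.
have [k nk] := recurrence_rev_far lm qr n nJ.
rewrite (iter_invB _ _ nk) => wJ.
exists (iter (k - n) (iet_inv T) z), (k - n)%N; rewrite iter_mapKV; split => //; lra.
Qed.

End Minimality.

(** * Interval exchanges from a pair of partitions *)

Section Partition.
Variables (R : realType) (A : finType).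
Implicit Types (g d w : A -> R) (p q t x : R).

(** Additivity of Lebesgue measure on the disjoint union spares sorting the pieces. *)
Lemma partition_sum (P : pred A) p t g w : p <= t -> (forall a, 0 < w a) ->
  (forall x, p <= x < t <-> exists2 a, P a & g a <= x < g a + w a) ->
  (forall a b x, g a <= x < g a + w a -> g b <= x < g b + w b -> a = b) ->
  t = p + \sum_(a | P a) w a.
Proof.
move=> pt w0 cov disj.
pose F a : set R := if P a then `[g a, g a + w a[%classic else set0.
have FE a x : F a x <-> P a /\ g a <= x < g a + w a.
  by rewrite /F; case: (P a); rewrite /= ?in_itv /=; split=> // -[].
have E : `[p, t[%classic = \bigcup_(a in [set: A]) F a.
  apply/seteqP; split => x; rewrite /= in_itv /=.
    by move=> /cov[a Pa xa]; exists a => //; apply/FE.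
  by move=> [a _ /FE[Pa xa]]; apply/cov; exists a.
have /(congr1 (@lebesgue_measure R)) := E.
rewrite measure_fin_bigcup //=; last 2 first.
- by move=> a b _ _ [x [/FE[_ xa] /FE[_ xb]]]; exact: disj xa xb.
- by move=> a _; rewrite /F; case: (P a).
have -> : [set: A] = [set` enum A].
  by apply/seteqP; split => // a _ /=; rewrite mem_enum.
rewrite -fsbig_seq ?enum_uniq // big_enum /= (eq_bigr (fun a => (if P a then w a else 0)%:E)); last first.
  move=> a _; rewrite /F; case: (P a); last by rewrite measure0.
  rewrite lebesgue_measure_itv /= lte_fin ltrDl w0 -EFinD; congr (_%:E); lra.
rewrite sumEFin -big_mkcond /= lebesgue_measure_itv /= lte_fin.
have [p_lt_t|t_le_p] := ltrP p t.
  by rewrite -EFinD => -[<-]; rewrite addrCA subrr addr0.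
by move=> [<-]; apply/eqP; rewrite addr0 eq_le pt t_le_p.
Qed.

(** This is the formula defining [mu], for the order of the left end points. *)
Lemma partition_mu p q g w : (forall a, 0 < w a) ->
  (forall x, p <= x < q <-> exists a, g a <= x < g a + w a) ->
  (forall a b x, g a <= x < g a + w a -> g b <= x < g b + w b -> a = b) ->
  forall a, g a + w a = p + \sum_(b | g b <= g a) w b.
Proof.
move=> w0 cov disj a; have wa := w0 a.
have pa : p <= g a < q by apply/cov; exists a; lra.
apply: (partition_sum (g := g)) => //; first lra.
move=> x; split.
  move=> /andP[px xa]; have /cov[b xb] : p <= x < q.
    have [ax|xa'] := lerP (g a) x; last lra.
    by apply/cov; exists a; lra.
  exists b => //; rewrite leNgt; apply/negP => ab.
  have ba : b = a by apply: (disj _ _ x) => //; lra.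
  by move: ab; rewrite ba ltxx.
move=> [b ba xb]; have /andP[px _] : p <= x < q by apply/cov; exists b.
rewrite px /= ltNge; apply/negP => ax.
have E : b = a by apply: (disj _ _ (g a)); lra.
by move: xb ax; rewrite E; lra.
Qed.

Lemma iet_of_partition p q g d w : (0 < #|A|)%N -> p <= q -> (forall a, 0 < w a) ->
  (forall x, p <= x < q <-> exists a, g a <= x < g a + w a) ->
  (forall a b x, g a <= x < g a + w a -> g b <= x < g b + w b -> a = b) ->
  (forall x, p <= x < q <-> exists a, d a <= x < d a + w a) ->
  (forall a b x, d a <= x < d a + w a -> d b <= x < d b + w b -> a = b) ->
  exists S : iet R A, [/\ left_end S = p, right_end S = q,
    forall a, gamma S a = g a, forall a, delta S a = d a & forall a, len S a = w a].
Proof.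
move=> A0 pq w0 covg disjg covd disjd.
have anti (h : A -> R) : (forall a b x, h a <= x < h a + w a -> h b <= x < h b + w b -> a = b) ->
    antisymmetric (fun a b => h a <= h b).
  move=> disj a b; rewrite -eq_le => /eqP E; apply: (disj _ _ (h a)).
    by rewrite lexx ltrDl w0.
  by rewrite E lexx ltrDl w0.
have tr (h : A -> R) : transitive (fun a b => h a <= h b).
  by move=> a b c; exact: le_trans.
have tot (h : A -> R) : total (fun a b => h a <= h b).
  by move=> a b; exact: le_total.
exists (Iet p A0 w0 (anti g disjg) (tr g) (tot g) (anti d disjd) (tr d) (tot d)).
split => //.
- rewrite /right_end /=; symmetry.
  apply: (partition_sum (P := predT) (g := g)) => //.
  move=> x; split; first by move=> /covg[a xa]; exists a.
  by move=> [a _ xa]; apply/covg; exists a.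
- move=> a; rewrite /gamma /mu /=.
  by rewrite -(partition_mu w0 covg disjg) addrK.
- move=> a; rewrite /delta /nu /=.
  by rewrite -(partition_mu w0 covd disjd) addrK.
Qed.

End Partition.

(** * The transformation induced on an admissible interval *)

Section Induced.
Variables (R : realType) (A : finType).
Implicit Types (S : iet R A) (x y w c g z : R) (a b : A).
Variables (T : iet R A) (p q : R).
Local Notation f := (iet_map T).
Local Notation O := (`]p, q[%classic).
Local Notation J := (`[p, q[%classic).
Hypotheses (A1 : (1 < #|A|)%N) (reg : sep_free T).
Hypotheses (lp : left_end T <= p) (pq : p < q) (qr : q <= right_end T).
Hypothesis pP : p = left_end T \/ exists2 g, sep T g & arc f O p g.
Hypothesis qP : q = right_end T \/ exists2 g, sep T g & arc f O q g.
Local Notation C := (cut T p q (sep T)).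

Lemma in_coE x : J x = (p <= x < q) :> Prop.
Proof. by rewrite /= in_itv. Qed.

Let sepP g : sep T g -> sep T g := id.

Definition returns_at x n := [/\ (0 < n)%N, p <= iter n f x < q &
  forall k, (0 < k < n)%N -> ~ p <= iter k f x < q].

Lemma return_timeE x n : return_time T J x n <-> returns_at x n.
Proof.
rewrite /return_time in_coE.
by split=> -[n0 nJ nmin]; split=> // k /nmin; rewrite in_coE.
Qed.

Lemma returns_at_uniq x n m : returns_at x n -> returns_at x m -> n = m.
Proof.
move=> [n0 nJ nmin] [m0 mJ mmin]; have [nm|mn|//] := ltngtP n m.
  by exfalso; apply: (mmin n) => //; rewrite n0.
by exfalso; apply: (nmin m) => //; rewrite m0.
Qed.

Lemma same_return x y n : p <= x -> x <= y -> y < q ->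
  (forall c, C c -> ~ x < c <= y) -> returns_at x n ->
  forall w, x <= w <= y -> returns_at w n /\ iter n f w = iter n f x + (w - x).
Proof.
move=> px xy yq nc [n0 nJ nmin] w wb.
have tw := tower lp qr sepP pP px xy yq nc nmin.
have [tr _ _] := tw n (leqnn n).
split; last exact: tr.
split => //; first exact: (tower_return lp qr sepP pP qP px xy yq nc nmin n0 nJ wb).
move=> k kb; have [_ h _] := tw k ltac:(by case/andP: kb => _ /ltnW).
exact: (h kb w wb).
Qed.

Definition same_itinerary x y := exists n, [/\ return_time T J x n, return_time T J y n &
  forall k, (k < n)%N -> exists b, piece T b (iter k f x) /\ piece T b (iter k f y)].

Lemma same_itinerary_sym x y : same_itinerary x y -> same_itinerary y x.
Proof.
by move=> [n [h1 h2 h]]; exists n; split => // k /h[b [b1 b2]]; exists b.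
Qed.

(** Without cuts, this is the tower. Conversely, equal itineraries make [[x, y]] move rigidly up to
    its return time [n]. A cut in []x, y]] that met its separation point before time [n] would put
    it inside a piece, beyond the left end; if it met it later, the visit to []p, q[] at time [n]
    would intervene. *)
Lemma same_itineraryP x y : p <= x -> x <= y -> y < q ->
  same_itinerary x y <-> (forall c, C c -> ~ x < c <= y).
Proof.
move=> px xy yq; split; last first.
  move=> nc; have [n nx] := first_return lp qr (x := x) ltac:(by rewrite px (le_lt_trans xy)).
  have [ny _] := same_return px xy yq nc nx (w := y) ltac:(by rewrite xy lexx).
  exists n; split; [exact/return_timeE|exact/return_timeE|] => k kn.
  have [tr _ h] := tower lp qr sepP pP px xy yq nc (let: And3 _ _ h := nx in h) (ltnW kn).
  have [a [xa ya]] := h kn; have Ey := tr y ltac:(by rewrite xy lexx).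
  by exists a; rewrite !pieceE; split; lra.
move=> [n [/return_timeE[n0 nJ _] /return_timeE[_ nJ' _] h]] c [cO [g sg [m Eg mO]]] cb.
have tr k w : (k <= n)%N -> x <= w <= y -> iter k f w = iter k f x + (w - x).
  elim: k w => [|k IH] w kn wb; first by rewrite /=; lra.
  have [b] := h k kn; rewrite !pieceE => -[xb yb].
  have Ew := IH w (ltnW kn) wb; have Ey := IH y (ltnW kn) ltac:(by rewrite xy lexx).
  rewrite /= (@iet_mapE _ _ T b (iter k f w)); last by move: wb; lra.
  by rewrite (@iet_mapE _ _ T b (iter k f x) xb); lra.
have nm : (n <= m)%N.
  rewrite leqNgt; apply/negP => mn; have [b] := h m mn; rewrite !pieceE => -[xb yb].
  have Ec := tr m c (ltnW mn) ltac:(lra); have Ey := tr m y (ltnW mn) ltac:(by rewrite xy lexx).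
  by apply: (@piece_sep _ _ T b g) => //; rewrite Eg Ec; lra.
apply: (mO n); first by rewrite n0.
have Ec := tr n c (leqnn n) ltac:(lra); have Ey := tr n y (leqnn n) ltac:(by rewrite xy lexx).
by rewrite in_ooE Ec; lra.
Qed.

Lemma last_visit z : iet_dom T z -> exists2 c, p < c < q & fwd f O c z.
Proof.
move=> zT; have [w [n [wO Ez]]] := minimal_backward A1 reg lp qr pq zT.
have ex : exists n, p < iter n (iet_inv T) z < q by exists n; rewrite Ez iter_mapVK.
case: (ex_minnP ex) => m mO mmin.
exists (iter m (iet_inv T) z) => //; exists m; first by rewrite iter_mapKV.
move=> j /andP[j0 jm]; rewrite in_ooE => jO.
have E : iter j f (iter m (iet_inv T) z) = iter (m - j) (iet_inv T) z.
  by rewrite -{1}(subnKC jm) iterD iter_mapKV.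
have := mmin (m - j)%N; rewrite -E => /(_ jO).
by rewrite leqNgt ltn_subrL j0 (leq_trans j0 jm).
Qed.

(** The cells are labelled by the letters: [p] for the piece of [T] that starts at [left_end T], and
    for every other [a] the last visit before [gamma T a]. A common last visit would put two
    separation points on one orbit, so no cell is lost. *)
Lemma cut_points : exists g : A -> R,
  [/\ injective g, forall a, g a = p \/ C (g a), exists a, g a = p &
      forall c, C c -> exists a, g a = c].
Proof.
have ex a : exists c, (gamma T a = left_end T /\ c = p) \/
    (sep T (gamma T a) /\ (p < c < q /\ fwd f O c (gamma T a))).
  have [gl|sg] := gamma_cases T a; first by exists p; left.
  by have [c cO hc] := last_visit (gamma_dom T a); exists c; right.
have [g hg] := choice ex; exists g; split.
- move=> a b E; have [[ga Ea]|[sa [aO ha]]] := hg a; have [[gb Eb]|[sb [bO hb]]] := hg b.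
  + by apply: (@gamma_inj _ _ T); rewrite ga gb.
  + by move: bO; rewrite -E Ea ltxx.
  + by move: aO; rewrite E Eb ltxx.
  + apply: (@gamma_inj _ _ T); rewrite -E in hb; case: (fwd_branch ha hb) => -[n En _].
      by move: (En) => /esym /(reg sa sb) n0; rewrite n0 in En.
    by move: (En) => /esym /(reg sb sa) n0; rewrite n0 in En.
- move=> a; have [[ga Ea]|[sa [aO ha]]] := hg a; first by left.
  by right; split => //; exists (gamma T a).
- have [a ga] := ex_gamma_left T; exists a; have [[_ //]|[sa _]] := hg a.
  by have := sep_dom sa; rewrite ga ltxx.
- move=> c [cO [_ [a la ->] hc]]; exists a; have [[ga _]|[sa [aO ha]]] := hg a.
    by have := gamma_nleast la; rewrite ga ltxx.
  by apply: (fwd_last_uniq (@iet_map_inj _ _ T) _ _ ha hc); rewrite in_ooE.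
Qed.

Lemma next_cut (g : A -> R) a : (forall b, g b < q) -> exists y,
  [/\ g a < y <= q, y = q \/ exists b, y = g b & forall b, ~ g a < g b < y].
Proof.
move=> gq; have [[b0 ab0]|nb] := pselect (exists b, g a < g b).
  case: (@arg_minP _ _ _ b0 (fun b => g a < g b) g ab0) => b ab bmin.
  exists (g b); split; [by rewrite ab ltW|by right; exists b|].
  by move=> c /andP[/bmin bc]; rewrite ltNge bc.
exists q; split; [by rewrite gq lexx|by left|].
by move=> b /andP[ab _]; apply: nb; exists b.
Qed.

Lemma induced_exists : exists S, is_induced_iet T J S.
Proof.
have [g [ginj gC [a0 ga0] Cg]] := cut_points.
have gJ a : p <= g a < q.
  by have [->|[/andP[/ltW -> ->]]//] := gC a; rewrite lexx pq.
have [nx hnx] := choice (fun a => @next_cut g a (fun b => let: conj _ h := andP (gJ b) in h)).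
pose w a := nx a - g a.
have gw a : g a + w a = nx a by rewrite /w addrCA subrr addr0.
have cell x : p <= x < q -> exists a, g a <= x < nx a.
  move=> /andP[px xq].
  have h0 : g a0 <= x by rewrite ga0.
  case: (@arg_maxP _ _ _ a0 (fun a => g a <= x) g h0) => a ax amax.
  exists a; rewrite ax ltNge; apply/negP => nxx.
  have [/andP[h1 h2] h3 h4] := hnx a; case: h3 => [E|[b E]].
    by rewrite E in nxx; move: (lt_le_trans xq nxx); rewrite ltxx.
  by have := amax b; rewrite -E => /(_ nxx) /=; rewrite leNgt h1.
have cell_uniq a b x : g a <= x < nx a -> g b <= x < nx b -> a = b.
  move=> /andP[a1 a2] /andP[b1 b2]; apply: ginj; have [ab|ba|//] := ltgtP (g a) (g b).
    have [_ _ h] := hnx a; exfalso; apply: (h b); rewrite ab /=; exact: le_lt_trans b1 a2.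
  have [_ _ h] := hnx b; exfalso; apply: (h a); rewrite ba /=; exact: le_lt_trans a1 b2.
have cellJ a x : g a <= x < nx a -> p <= x < q.
  by have [h _ _] := hnx a; have := gJ a; lra.
have nocut a x y c : g a <= x < nx a -> g a <= y < nx a -> C c -> ~ x < c <= y.
  move=> /andP[ax _] /andP[_ ya] /Cg[b <-] /andP[xb b_y].
  by have [_ _ h] := hnx a; apply: (h b); rewrite (le_lt_trans ax xb) (le_lt_trans b_y ya).
have [n hn] := choice (fun a => first_return lp qr (gJ a)).
pose d a := iter (n a) f (g a).
have ret a x : g a <= x < nx a -> returns_at x (n a) /\ iter (n a) f x = d a + (x - g a).
  move=> /[dup] xa /andP[ax x_lt]; have /andP[px xq] := cellJ a x xa.
  apply: (@same_return (g a) x (n a)) => //.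
  - by case/andP: (gJ a).
  - by move=> c; apply: (nocut a) => //; rewrite lexx (le_lt_trans ax x_lt).
  - by rewrite ax lexx.
have w0 a : 0 < w a by have [/andP[h _] _ _] := hnx a; rewrite subr_gt0.
have [|||||||S [lS rS gS dS wS]] := @iet_of_partition R A p q g d w.
- exact: ltnW.
- exact: ltW.
- exact: w0.
- move=> x; split; first by move=> /cell[a xa]; exists a; rewrite gw.
  by move=> [a]; rewrite gw => /cellJ.
- by move=> a b x; rewrite !gw; exact: cell_uniq.
- move=> x; split; last first.
    move=> [a]; rewrite /w => xa; pose x' := g a + (x - d a).
    have x'a : g a <= x' < nx a by rewrite /x'; move: xa; lra.
    have [[_ h _] E] := ret a x' x'a; move: h; rewrite E.
    by have -> : d a + (x' - g a) = x by rewrite /x'; lra.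
  (* The images cover [[p, q[]: the previous visit of the orbit of [x] lies in some cell, and its
     first return is [x]. *)
  move=> xJ; case: (ex_minnP (recurrence_rev lp qr xJ)) => m /andP[m0 mJ] mmin.
  have [a xa] := cell _ mJ; exists a; have [na E] := ret a _ xa.
  have nam : n a = m.
    apply: (returns_at_uniq na); split => //; first by rewrite iter_mapKV.
    move=> k /andP[k0 km] kJ; have := mmin (m - k)%N; rewrite subn_gt0 km /=.
    have <- : iter k f (iter m (iet_inv T) x) = iter (m - k) (iet_inv T) x.
      by rewrite -{1}(subnKC (ltnW km)) iterD iter_mapKV.
    by rewrite kJ => /(_ isT); rewrite leqNgt ltn_subrL k0 m0.
  move: E; rewrite nam iter_mapKV /w; move: xa; lra.
- move=> a b x; rewrite /w => xa xb.
  pose xA := g a + (x - d a); pose xB := g b + (x - d b).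
  have xAa : g a <= xA < nx a by rewrite /xA; move: xa; lra.
  have xBb : g b <= xB < nx b by rewrite /xB; move: xb; lra.
  have [ra Ea] := ret a xA xAa; have [rb Eb] := ret b xB xBb.
  have E : iter (n a) f xA = iter (n b) f xB by rewrite Ea Eb /xA /xB; lra.
  (* Injectivity of the first return: if two points reach the same point at their returns, the one
     that waits longer passes through the other. *)
  have H i j u v : returns_at u i -> returns_at v j -> p <= u < q ->
      iter i f u = iter j f v -> (i <= j)%N -> u = v.
    move=> [i0 _ _] [j0 _ jmin] uJ Euv ij.
    have E' : u = iter (j - i) f v.
      by apply: (@iter_inj _ f (@iet_map_inj _ _ T) i); rewrite -iterD subnKC.
    have [ji|ij'] := posnP (j - i)%N; first by rewrite E' ji.
    exfalso; apply: (jmin (j - i)%N); last by rewrite -E'.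
    by rewrite ij' ltn_subrL i0 j0.
  have EAB : xA = xB.
    have [ab|ba] := leqP (n a) (n b); first exact: (H _ _ _ _ ra rb (cellJ _ _ xAa) E ab).
    by apply/esym; apply: (H _ _ _ _ rb ra (cellJ _ _ xBb) (esym E)); exact: ltnW.
  by apply: (cell_uniq a b xA) => //; rewrite EAB.
exists S; have pS a x : piece S a x <-> g a <= x < nx a.
  by rewrite pieceE -gamma_mu gS wS gw.
split.
  split; first by rewrite /iet_dom lS rS.
  move=> z; rewrite in_coE => /cell[a za]; have [ra E] := ret a z za.
  exists (n a); first exact/return_timeE.
  rewrite (@iet_mapE _ _ S a); last by have /pS := za; rewrite pieceE.
  by rewrite dS gS E; lra.
have P x y : p <= x -> x <= y -> y < q ->
    (exists a, piece S a x /\ piece S a y) <-> same_itinerary x y.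
  move=> px xy yq; rewrite same_itineraryP //; split.
    by move=> [a [/pS xa /pS ya]] c; exact: (nocut a).
  move=> nc; have [a xa] := cell x ltac:(by rewrite px (le_lt_trans xy yq)).
  exists a; split; first exact/pS.
  apply/pS; move: (xa) => /andP[ax x_lt]; rewrite (le_trans ax xy) ltNge; apply/negP => ny.
  have [h1 [E|[b E]] _] := hnx a; first by rewrite E in ny; move: (le_lt_trans ny yq); rewrite ltxx.
  have [Eb|Cb] := gC b.
    by move: x_lt; rewrite E Eb ltNge px.
  by apply: (nc _ Cb); rewrite -E x_lt ny.
move=> x y; rewrite !in_coE => /andP[px xq] /andP[py yq].
have [xy|/ltW yx] := lerP x y; first exact: P.
have -> : (exists a, piece S a x /\ piece S a y) <-> (exists a, piece S a y /\ piece S a x).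
  by split => -[a [? ?]]; exists a.
rewrite (P y x) //; split; exact: same_itinerary_sym.
Qed.

Lemma iet_same_pieceP S x y : iet_dom S x -> iet_dom S y -> x <= y ->
  (exists a, piece S a x /\ piece S a y) <-> (forall s, sep S s -> ~ x < s <= y).
Proof.
move=> xS yS xy; split.
  move=> [a]; rewrite !pieceE => -[xa ya] s ss sb.
  by apply: (@piece_sep _ _ S a s) => //; move: xa ya sb; lra.
move=> /(same_piece xS yS xy)[a [xa ya]]; exists a; rewrite !pieceE.
by split; move: xa ya xy; lra.
Qed.

Lemma induced_ends S : iet_dom S = J -> left_end S = p /\ right_end S = q.
Proof.
move=> E; have lrS := left_lt_right S.
have D x : (left_end S <= x < right_end S) <-> (p <= x < q).
  by rewrite -iet_domE -in_coE E.
have /D h1 : left_end S <= left_end S < right_end S by rewrite lexx.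
have /D h2 : p <= p < q by rewrite lexx.
have El : left_end S = p by lra.
split => //; have [h|h|//] := ltgtP (right_end S) q.
  by have /D : p <= right_end S < q by [lra]; rewrite ltxx andbF.
by have /D : left_end S <= q < right_end S by [lra]; rewrite ltxx andbF.
Qed.

(** Through [same_itinerary_pieces], the separation points of [S] and the cuts avoid the same
    intervals []y, z]]. Both sets are finite, so a point in only one of them would be isolated by a
    small interval on its left. *)
Lemma sep_induced S x : is_induced_iet T J S -> sep S x <-> C x.
Proof.
move=> [[domS _] itS]; have [lS rS] := induced_ends domS.
have H y z : p <= y -> y <= z -> z < q ->
    (forall s, sep S s -> ~ y < s <= z) <-> (forall c, C c -> ~ y < c <= z).
  move=> py yz zq; rewrite -same_itineraryP // -iet_same_pieceP //.
  - by apply: itS; rewrite in_coE; move: py yz zq; lra.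
  - by rewrite iet_domE lS rS; move: py yz zq; lra.
  - by rewrite iet_domE lS rS; move: py yz zq; lra.
have [s hs] := cut_finite T p q (fun g => @sep_seqP _ _ T g).
split=> [sx|Cx]; apply: contrapT => nx.
  have /andP[px xq] := sep_dom sx; rewrite lS in px; rewrite rS in xq.
  have [y /andP[py yx] hy] := seq_gap_left s px.
  have /H : forall c, C c -> ~ y < c <= x.
    move=> c Cc /andP[yc]; rewrite le_eqVlt => /orP[/eqP E|cx].
      by apply: nx; rewrite -E.
    by apply: (hy c (hs _ Cc)); rewrite (ltW yc) cx.
  by move=> /(_ (ltW py) (ltW yx) xq x sx); apply; rewrite yx lexx.
have /andP[px xq] := proj1 Cx.
have [y /andP[py yx] hy] := seq_gap_left (sep_seq S) px.
have /H : forall c, sep S c -> ~ y < c <= x.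
  move=> c sc /andP[yc]; rewrite le_eqVlt => /orP[/eqP E|cx].
    by apply: nx; rewrite -E.
  by apply: (hy c (sep_seqP sc)); rewrite (ltW yc) cx.
by move=> /(_ (ltW py) (ltW yx) xq x Cx); apply; rewrite yx lexx.
Qed.

End Induced.

(** * Admissibility under induction *)

Section FirstReturn.
Variables (X : Type) (f F : X -> X) (J O : set X).
Hypothesis OJ : O `<=` J.
Hypothesis FE : forall z, J z -> exists n, [/\ (0 < n)%N, J (iter n f z),
  forall m, (0 < m < n)%N -> ~ J (iter m f z) & F z = iter n f z].

Lemma first_return_in z : J z -> J (F z).
Proof. by move=> /FE[n [_ h _ ->]]. Qed.

Lemma iter_first_return n z : J z -> exists2 m, (n <= m)%N & iter n F z = iter m f z.
Proof.
elim: n z => [|n IH] z zJ; first by exists 0%N.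
have [m nm E] := IH _ (first_return_in zJ); have [k [k0 _ _ Ek]] := FE zJ.
by exists (m + k)%N; [rewrite -addn1 leq_add|rewrite iterSr E Ek iterD].
Qed.

Lemma fwd_first_return x y : J x -> fwd F O x y -> fwd f O x y.
Proof.
move=> xJ [n -> nO]; elim: n x xJ nO => [|n IH] x xJ nO; first exact: fwd_refl.
rewrite iterSr; apply: (fwd_trans _ (IH _ (first_return_in xJ) _)); last first.
  by move=> j /andP[_ jn]; rewrite -iterSr; apply: nO.
have [k [k0 kJ kmin Ek]] := FE xJ; exists k => // j /andP[j0 jk].
move: jk; rewrite leq_eqVlt => /orP[/eqP ->|jk]; first by rewrite -Ek; exact: (nO 1%N).
by move=> /OJ; apply: kmin; rewrite j0.
Qed.

Lemma first_return_fwd x y : J x -> J y -> fwd f O x y -> fwd F O x y.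
Proof.
move=> xJ yJ [m Ey mO]; elim/ltn_ind: m x xJ Ey mO => -[|m] IH x xJ Ey mO.
  by rewrite Ey; exact: fwd_refl.
have [k [k0 kJ kmin Ek]] := FE xJ.
have km : (k <= m.+1)%N.
  by rewrite leqNgt; apply/negP => mk; apply: (kmin m.+1) => //; rewrite -Ey.
apply: (fwd_trans (y := F x)).
  by apply: fwd_step; rewrite Ek; apply: mO; rewrite k0.
apply: (IH (m.+1 - k)%N); first by rewrite ltn_subrL k0.
- exact: first_return_in.
- by rewrite Ek -iterD subnK.
move=> j /andP[j0 jm]; rewrite Ek -iterD; apply: mO.
by rewrite addn_gt0 j0 /= -(subnK km) leq_add2r.
Qed.

(** Between consecutive returns the orbit of [f] stays outside [J], hence outside [O]. *)
Lemma arc_first_return x y : J x -> J y -> arc F O x y <-> arc f O x y.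
Proof.
move=> xJ yJ; split=> -[h|h]; [left|right|left|right];
  by [exact: fwd_first_return|exact: first_return_fwd].
Qed.

End FirstReturn.

Section Step.
Variables (R : realType) (A : finType).
Implicit Types (T S : iet R A) (x y u v p q : R) (a b : A).

Lemma admissibleP T u v : (1 < #|A|)%N -> sep_free T -> admissible T u v <->
  [/\ left_end T <= u, u < v, v <= right_end T,
      exists2 g, sep T g & arc (iet_map T) (`]u, v[%classic) u g &
      v = right_end T \/ exists2 g, sep T g & arc (iet_map T) (`]u, v[%classic) v g].
Proof.
move=> A1 reg; split=> -[lu uv vr hu hv]; split => //.
- case: hu => [/(DivP _ _ A1 reg lu) //|/= ur].
  by move: uv; rewrite ur ltNge vr.
- by case: hv => [/(DivP _ _ A1 reg lu)|]; [right|left].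
- by left; apply/(DivP _ _ A1 reg lu).
- by case: hv => [|h]; [right|left; apply/(DivP _ _ A1 reg lu)].
Qed.

Lemma Div_left T u v : left_end T <= u -> Div T u v (left_end T).
Proof.
move=> lu; have [a ga] := ex_gamma_left T; exists a => //; apply/neighborsP.
by rewrite ga; left; exact: fwd_refl.
Qed.

Lemma Div_gamma T u v a : Div T u v (gamma T a).
Proof. by exists a => //; apply/neighborsP; left; exact: fwd_refl. Qed.

Lemma Div_delta T u v a : ~ u < delta T a < v -> Div T u v (delta T a).
Proof.
move=> h; exists a => //; apply/neighborsP; left; rewrite -iet_map_gamma.
by apply: fwd_step; rewrite iet_map_gamma in_ooE.
Qed.

Section Ind.
Variables (T S : iet R A) (p q : R).
Hypotheses (A1 : (1 < #|A|)%N) (reg : sep_free T).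
Hypotheses (adm : admissible T p q) (ind : is_induced_iet T `[p, q[%classic S).

Let lp : left_end T <= p. Proof. by case: adm. Qed.
Let pq : p < q. Proof. by case: adm. Qed.
Let qr : q <= right_end T. Proof. by case: adm. Qed.
Let pP : p = left_end T \/ exists2 g, sep T g & arc (iet_map T) (`]p, q[%classic) p g.
Proof. by right; case/(admissibleP _ _ A1 reg): adm. Qed.
Let qP : q = right_end T \/ exists2 g, sep T g & arc (iet_map T) (`]p, q[%classic) q g.
Proof. by case/(admissibleP _ _ A1 reg): adm. Qed.
Let sepS x : sep S x <-> cut T p q (sep T) x.
Proof. exact (sep_induced lp pq qr pP qP x ind). Qed.
Let ends : left_end S = p /\ right_end S = q.
Proof. by case: ind => -[domS _] _; exact: induced_ends. Qed.

Let retS z : `[p, q[%classic z -> exists n, [/\ (0 < n)%N, `[p, q[%classic (iter n (iet_map T) z),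
  forall m, (0 < m < n)%N -> ~ `[p, q[%classic (iter m (iet_map T) z) &
  iet_map S z = iter n (iet_map T) z].
Proof. by case: ind => -[_ h] _ /h[n [n0 nJ nmin] E]; exists n. Qed.

Let oo_co : `]p, q[%classic `<=` `[p, q[%classic.
Proof. by move=> x; rewrite in_ooE in_coE => /andP[/ltW -> ->]. Qed.

(** Let [x] and [y] be cuts on one orbit of [S], followed by the separation points [g] and [h].
    Keane's condition for [T] forces [g = h], reached at the same time from [x]; then [y] would be a
    visit to []p, q[] between [x] and [g], unless no step was taken. *)
Lemma induced_sep_free : sep_free S.
Proof.
move=> x y n /sepS[xO [g sg [a Ea aO]]] /sepS[yO [h sh [b Eb bO]]] Exy.
have xJ : `[p, q[%classic x by apply: oo_co; rewrite in_ooE.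
have [m nm Em] := iter_first_return retS n xJ.
rewrite Em in Exy.
have Eh : h = iter (m + b) (iet_map T) x by rewrite addnC iterD Exy.
have amb : a = (m + b)%N.
  have [le_a|lt_a] := leqP a (m + b).
    have E : iter (m + b - a) (iet_map T) g = h.
      by rewrite Ea -iterD subnK.
    have /eqP := reg sg sh E; rewrite subn_eq0 => le_b.
    by apply/eqP; rewrite eqn_leq le_a.
  have E : iter (a - (m + b)) (iet_map T) h = g.
    by rewrite Eh -iterD subnK // ltnW.
  by have /eqP := reg sh sg E; rewrite subn_eq0 leqNgt lt_a.
have [m0|m0] := posnP m; first by move: nm; rewrite m0 leqn0 => /eqP.
by exfalso; apply: (aO m); [rewrite m0 amb leq_addr | rewrite Exy in_ooE].
Qed.

(** A separation point of [T] and its cut, which is a separation point of [S], are linked relative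
    to []p, q[] and a fortiori to the smaller []u, v[]. *)
Lemma induced_Div u v x : p <= u -> v <= q -> p <= x < q ->
  Div S u v x <-> Div T u v x.
Proof.
move=> pu vq xJ; have [lS rS] := ends; have regS := induced_sep_free.
rewrite (DivP _ _ A1 regS) ?lS // (DivP _ _ A1 reg) ?(le_trans lp pu) //.
have sub : `]u, v[%classic `<=` `]p, q[%classic.
  by move=> y; rewrite !in_ooE; move: pu vq; lra.
have arcE c : cut T p q (sep T) c -> arc (iet_map S) (`]u, v[%classic) x c <->
    arc (iet_map T) (`]u, v[%classic) x c.
  move=> [cO _]; apply: (arc_first_return (subset_trans sub oo_co) retS).
    by rewrite in_coE.
  by apply: oo_co; rewrite in_ooE.
split.
  move=> [c /sepS Cc /(arcE _ Cc) xc]; have [_ [g sg cg]] := Cc; exists g => //.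
  by apply: (arc_trans (@iet_map_inj _ _ T) xc); left; exact: fwd_sub cg.
move=> [g sg xg].
have gT : iet_dom T g by rewrite iet_domE; case/andP: (sep_dom sg) => /ltW -> ->.
have [c cO cg] := last_visit A1 reg lp pq qr gT.
have Cc : cut T p q (sep T) c by split => //; exists g.
exists c; first exact/sepS.
apply/arcE => //; apply: (arc_trans (@iet_map_inj _ _ T) xg); right; exact: fwd_sub cg.
Qed.

(** The delicate value is [v = q], the exceptional end point for [S] but perhaps not for [T]. There
    the admissibility of [[p, q[] helps: links relative to []p, q[] persist for []u, v[]. *)
Lemma induced_admissible u v : p <= u -> v <= q -> admissible S u v <-> admissible T u v.
Proof.
move=> pu vq; have [lS rS] := ends.
have subD x : Div T p q x -> Div T u v x.
  move=> [a _ /neighborsP h]; exists a => //; apply/neighborsP.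
  by apply: arc_sub h => y; rewrite !in_ooE; move: pu vq; lra.
have hq : (Div T u v `|` [set right_end T]) q.
  by case: adm => _ _ _ _ [/subD|]; [left|right].
split=> -[h1 uv h2 hu hv]; split; rewrite ?lS ?rS //.
- exact: le_trans lp pu.
- exact: le_trans vq qr.
- case: hu => [/induced_Div hu|/= ur]; first by left; apply: hu => //; lra.
  by move: uv; rewrite ur rS; lra.
- case: hv => [hv|/= vE].
    have [vlt|vge] := ltrP v q; first by left; apply/induced_Div => //; lra.
    by move: hq; have -> : q = v by lra.
  by move: hq; rewrite vE rS.
- case: hu => [hu|/= ur]; first by left; apply/induced_Div => //; lra.
  by move: uv; rewrite ur; move: vq qr; lra.
- have [vlt|vge] := ltrP v q; last by right => /=; lra.
  case: hv => [hv|/= vE]; first by left; apply/induced_Div => //; move: pu uv; lra.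
  by move: vlt; rewrite vE ltNge qr.
Qed.

End Ind.
End Step.

(** * Rauzy inductions *)

Section Rauzy.
Variables (R : realType) (A : finType).
Implicit Types (T S U : iet R A) (x y u v p q : R) (a b c : A).

Lemma one_letter (a b : A) : ~~ (1 < #|A|)%N -> a = b.
Proof. by rewrite -leqNgt => /card_le1_eqP h; exact: h. Qed.

Lemma gamma_gt_card T a : left_end T < gamma T a -> (1 < #|A|)%N.
Proof.
move=> la; apply: contraLR la => A1; rewrite -leNgt le_eqVlt gamma_least ?eqxx // => b.
by rewrite (one_letter b a A1) (le_reflexive (@le1_total _ _ T)).
Qed.

Lemma delta_gt_card T b : left_end T < delta T b -> (1 < #|A|)%N.
Proof. exact: (@gamma_gt_card (iet_rev T)). Qed.

Lemma mu_le_gamma T a c : Defs.le1 T a c -> a != c -> mu T a <= gamma T c.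
Proof.
exact: (@psum_sep _ _ _ (left_end T) _ (@le1_anti _ _ T) (@le1_trans _ _ T)
    (@le1_total _ _ T) (@len_gt0 _ _ T) a c).
Qed.

Lemma nu_le_delta T b c : le2 T b c -> b != c -> nu T b <= delta T c.
Proof. exact: (@mu_le_gamma (iet_rev T)). Qed.

Lemma gamma_le_greatest T a c : greatest (Defs.le1 T) a -> gamma T c <= gamma T a.
Proof.
move=> ga; have [->//|ca] := eqVneq c a.
exact: le_trans (ltW (gamma_lt_mu T c)) (mu_le_gamma (ga c) ca).
Qed.

Lemma delta_le_greatest T b c : greatest (le2 T) b -> delta T c <= delta T b.
Proof. exact: (@gamma_le_greatest (iet_rev T)). Qed.

Lemma delta_dom T b : left_end T <= delta T b < right_end T.
Proof. by rewrite -iet_domE; exact: (@gamma_dom _ _ (iet_rev T)). Qed.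

Lemma next_image T b : nu T b < right_end T -> exists c, delta T c = nu T b.
Proof. exact: (@next_letter _ _ (iet_rev T)). Qed.

Lemma admissible_right T a b :
  left_end T < Num.max (gamma T a) (delta T b) ->
  admissible T (left_end T) (Num.max (gamma T a) (delta T b)).
Proof.
have ga := gamma_dom T a; rewrite iet_domE in ga; have db := delta_dom T b.
move=> lq; split => //; first by rewrite ge_max; apply/andP; split; lra.
  by left; exact: Div_left.
left; case: (leP (gamma T a) (delta T b)) => _; last exact: Div_gamma.
by apply: Div_delta; rewrite ltxx andbF.
Qed.

Lemma admissible_left T a b :
  Num.min (mu T a) (nu T b) < right_end T ->
  admissible T (Num.min (mu T a) (nu T b)) (right_end T).
Proof.
have := gamma_dom T a; rewrite iet_domE => ga; have db := delta_dom T b.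
have la := gamma_lt_mu T a.
have lb : delta T b < nu T b by rewrite -delta_nu ltrDl len_gt0.
move=> pr; split => //; last by right.
  by rewrite le_min; apply/andP; split; lra.
left; move: pr; case: (leP (mu T a) (nu T b)) => _ pr.
  by have [c <-] := next_letter pr; exact: Div_gamma.
by have [c <-] := next_image pr; apply: Div_delta; rewrite ltxx.
Qed.

Lemma admissible_induced T p q : (1 < #|A|)%N -> sep_free T -> admissible T p q ->
  exists S, is_induced_iet T `[p, q[%classic S.
Proof.
move=> A1 reg /(admissibleP _ _ A1 reg)[lp pq qr hp hq].
by apply: induced_exists => //; right.
Qed.

Lemma rauzy_step_induced w U S : rauzy_step w U S ->
  is_induced U (iet_dom S) S /\ iet_dom S `<=` iet_dom U.
Proof.
case: w => -[a [b [_ _ [[domS h] _]]]]; (split; first by rewrite domS);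
  rewrite domS => x; rewrite iet_domE /= in_itv /=.
  have := gamma_dom U a; rewrite iet_domE => ga; have db := delta_dom U b.
  have la := gamma_lt_mu U a.
  have lb : delta U b < nu U b by rewrite -delta_nu ltrDl len_gt0.
  by rewrite ge_min => /andP[/orP[h1|h1] ->]; rewrite andbT; lra.
have := gamma_dom U a; rewrite iet_domE => ga; have db := delta_dom U b.
by rewrite lt_max => /andP[-> /orP[h1|h1]] /=; lra.
Qed.

(** With one letter a Rauzy step would leave the empty interval, whereas the domain of [S] is
    nonempty; so a step forces two letters. *)
Lemma rauzy_step_admissible w U S : rauzy_step w U S ->
  exists p q, [/\ (1 < #|A|)%N, admissible U p q & is_induced_iet U `[p, q[%classic S].
Proof.
move=> step; have := left_lt_right S; move: step.
case: w => -[a [b [_ _ ind]]] lrS; have [[domS _] _] := ind.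
  have : iet_dom S (left_end S) by rewrite iet_domE lexx.
  rewrite domS /= in_itv /= => /andP[h1 h2]; have pr := le_lt_trans h1 h2.
  exists (Num.min (mu U a) (nu U b)), (right_end U); split => //; last exact: admissible_left.
  move: pr; rewrite gt_min => /orP[/next_letter[c Ec]|/next_image[c Ec]].
    apply: (@gamma_gt_card U c); rewrite Ec; exact: le_lt_trans (left_le_gamma U a) (gamma_lt_mu U a).
  apply: (@delta_gt_card U c); rewrite Ec -delta_nu.
  by have := delta_dom U b; have := len_gt0 U b; lra.
have : iet_dom S (left_end S) by rewrite iet_domE lexx.
rewrite domS /= in_itv /= => /andP[h1 h2]; have lq := le_lt_trans h1 h2.
exists (left_end U), (Num.max (gamma U a) (delta U b)); split => //; last exact: admissible_right.
by move: lq; rewrite lt_max => /orP[/gamma_gt_card|/delta_gt_card].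
Qed.

Lemma rauzy_word_rcons chi w T U S :
  rauzy_step w T U -> rauzy_word chi U S -> rauzy_word (rcons chi w) T S.
Proof.
move=> TU; elim: chi S => [|w' chi IH] S /=; first by move=> ->; exists T.
by move=> [V /IH UV VS]; exists V.
Qed.

Lemma rauzy_word_invariant chi T S : sep_free T -> rauzy_word chi T S ->
  [/\ sep_free S, left_end T <= left_end S, right_end S <= right_end T &
    forall u v, left_end S <= u -> v <= right_end S ->
      (admissible S u v <-> admissible T u v)].
Proof.
move=> reg; elim: chi S => [|w chi IH] S /=; first by move=> ->; split.
move=> [U /IH[regU lU rU admU] /rauzy_step_admissible[p [q [A1 adm ind]]]].
have pq : p < q by case: adm.
have [lp qr] : left_end U <= p /\ q <= right_end U by case: adm.
have [lS rS] := induced_ends pq (proj1 (proj1 ind)).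
split.
- exact: induced_sep_free A1 regU adm ind.
- by rewrite lS (le_trans lU).
- by rewrite rS (le_trans _ rU).
- move=> u v; rewrite lS rS => pu vq.
  rewrite (induced_admissible A1 regU adm ind pu vq).
  by apply: admU; [exact: le_trans lp pu|exact: le_trans vq qr].
Qed.

(** As [J] lies in the domain of [U], no visit to [J] occurs between consecutive visits to that
    domain, and return times add up. *)
Lemma return_time_trans (T U : iet R A) (J : set R) n z :
  is_induced T (iet_dom U) U -> J `<=` iet_dom U -> iet_dom U z ->
  return_time U J z n -> exists2 m, return_time T J z m &
    iter n (iet_map U) z = iter m (iet_map T) z.
Proof.
move=> [_ indU] JU; elim: n z => [|n IH] z zU [n0 nJ nmin] //.
have [k [k0 kU kmin] Ek] := indU z zU.
have [n_0|n_gt0] := posnP n.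
  exists k; last by rewrite n_0 /= Ek.
  split => //; first by move: nJ; rewrite n_0 /= Ek.
  by move=> m mk /JU; exact: kmin.
have FU : iet_dom U (iet_map U z) by exact: iet_map_dom.
have [|m [m0 mJ mmin] Em] := IH _ FU.
  split => //; first by rewrite -iterSr.
  by move=> j /andP[j0 jn]; rewrite -iterSr; apply: nmin.
exists (m + k)%N; last by rewrite iterSr Em Ek -iterD.
split; first by rewrite addn_gt0 m0.
  by rewrite iterD -Ek.
move=> j /andP[j0 jmk]; have [jk|kj|->] := ltngtP j k.
- by move=> /JU; apply: kmin; rewrite j0.
- rewrite -(subnK (ltnW kj)) iterD -Ek; apply: mmin.
  by rewrite subn_gt0 kj ltn_subLR ?(ltnW kj)// addnC.
- by rewrite -Ek; apply: (nmin 1%N).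
Qed.

Lemma rauzy_word_induced chi T S : rauzy_word chi T S ->
  is_induced T (iet_dom S) S /\ iet_dom S `<=` iet_dom T.
Proof.
elim: chi S => [|w chi IH] S /=.
  move=> ->; split => //; split => // z zT; exists 1%N => //; split => //.
    exact: iet_map_dom.
  by move=> [|[|]].
move=> [U /IH[indU UT] /rauzy_step_induced[[_ indS] SU]]; split; last exact: subset_trans SU UT.
split => // z zS; have [n nret ->] := indS z zS.
by apply: return_time_trans nret => //; exact: SU.
Qed.

Lemma Div_dom T u v x : Div T u v x -> iet_dom T x.
Proof.
move=> [a _ /neighborsP[[n -> _]|[n E _]]]; first exact: iter_dom (gamma_dom T a).
by apply: (@iter_domE _ _ T n); rewrite -E; exact: gamma_dom.
Qed.

(** By minimality each separation point visits []u, v[] in the future and in the past, which bounds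
    both halves of its class. *)
Lemma Div_finite T u v : (1 < #|A|)%N -> sep_free T ->
  left_end T <= u -> u < v -> v <= right_end T ->
  exists s : seq R, forall x, Div T u v x -> x \in s.
Proof.
move=> A1 reg lu uv vr.
have fin a : exists s : seq R, forall x, neighbors T u v (gamma T a) x -> x \in s.
  have [n n0 nO] := minimal_forward A1 reg lu vr uv (gamma_dom T a).
  have [w [m [wO Em]]] := minimal_backward A1 reg lu vr uv (gamma_dom T a).
  (* The future visit, at time [n], is excluded from the class, while the past one, at time [m], may
     belong to it. *)
  exists ([seq iter k (iet_map T) (gamma T a) | k <- iota 0 n] ++
          [seq iter k (iet_inv T) (gamma T a) | k <- iota 0 m.+1]) => x.
  move=> /neighborsP[[k -> kO]|[k Ek kO]]; rewrite mem_cat.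
    apply/orP; left; apply/mapP; exists k => //; rewrite mem_iota /= add0n ltnNge.
    by apply/negP => nk; apply: (kO n); rewrite ?n0 ?in_ooE.
  apply/orP; right; have -> : x = iter k (iet_inv T) (gamma T a).
    by rewrite Ek iter_mapVK.
  apply/mapP; exists k => //; rewrite mem_iota /= add0n ltnS leqNgt; apply/negP => mk.
  apply: (kO (k - m)%N); first by rewrite subn_gt0 mk leq_subr.
  have -> : iter (k - m) (iet_map T) x = w; last by rewrite in_ooE.
  apply: (@iter_inj _ _ (@iet_map_inj _ _ T) m).
  by rewrite -iterD subnKC ?(ltnW mk)// -Ek.
have [s hs] := choice fin; exists (flatten [seq s a | a <- enum A]) => x [a _ xa].
by apply/flatten_mapP; exists a; rewrite ?mem_enum//; exact: hs.
Qed.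

(** All separation points, and all [delta T c] with [c != b], lie in []u, v[]. So links end at once,
    except from [gamma T b] to its image [left_end T], whose own image [delta T a] is again inside.
    Thus Div has no point outside []u, v[] but [left_end T]. *)
Lemma admissible_exhaust T u v a a' b b' : (1 < #|A|)%N -> sep_free T ->
  least (Defs.le1 T) a -> greatest (Defs.le1 T) a' ->
  least (le2 T) b -> greatest (le2 T) b' -> admissible T u v ->
  u < Num.min (mu T a) (nu T b) -> Num.max (gamma T a') (delta T b') < v ->
  u = left_end T /\ v = right_end T.
Proof.
move=> A1 reg la ga' lb gb' adm; rewrite lt_min gt_max => /andP[ua ub] /andP[a'v b'v].
have [lu uv vr uD vD] := adm.
have dO c : c != b -> u < delta T c < v.
  move=> cb; rewrite (lt_le_trans ub) /=.
    exact: le_lt_trans (delta_le_greatest c gb') b'v.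
  by apply: nu_le_delta; rewrite ?lb// eq_sym.
have DE x : Div T u v x -> u < x < v \/ x = left_end T.
  move=> /(DivP _ _ A1 reg lu)[_ [c nlc ->] xc].
  have ac : a != c by apply: contra_notN nlc => /eqP <-.
  have gO : u < gamma T c < v.
    rewrite (lt_le_trans ua (mu_le_gamma (la c) ac)) /=.
    exact: le_lt_trans (gamma_le_greatest c ga') a'v.
  have [n -> nO] : fwd (iet_map T) (`]u, v[%classic) (gamma T c) x.
    by apply: arc_fwd; [rewrite in_ooE|exact: arc_sym].
  case: n nO => [|n] nO; first by left.
  have cb : c = b.
    apply/eqP; apply: contrapT => /negP /dO; rewrite -iet_map_gamma -in_ooE.
    exact: (nO 1%N).
  case: n nO => [|n] nO; first by right; rewrite /= iet_map_gamma cb delta_left.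
  exfalso; apply: (nO 2%N) => //; rewrite in_ooE /= iet_map_gamma cb delta_left //.
  by rewrite -(gamma_least la) iet_map_gamma; apply: dO; exact: least_neq lb.
split.
  case: uD => [/DE[|//]|/= ur]; first by rewrite ltxx.
  by move: uv; rewrite ur ltNge vr.
case: vD => [/DE[|vl]|//]; first by rewrite ltxx andbF.
by move: (le_lt_trans lu uv); rewrite vl ltxx.
Qed.

Lemma ex_least (le : rel A) : (0 < #|A|)%N -> antisymmetric le -> transitive le -> total le ->
  exists a, least le a.
Proof.
move=> A0 anti tr tot; pose le' a b := le b a.
(* A greatest letter of the reversed order; the origin 0 and the unit weights are arbitrary. *)
have [||||a ga] := @ex_greatest R A le' 0 (fun=> 1) _ _ _ _ A0.
- by move=> a b; rewrite /le' andbC => /anti.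
- by move=> a b c h1 h2; exact: tr h2 h1.
- by move=> a b; rewrite /le' orbC.
- by move=> a; exact: ltr01.
by exists a.
Qed.

(* The point [e] leaves Div in this step, which makes the iteration stop. *)
Lemma rauzy_progress T u v : (1 < #|A|)%N -> sep_free T -> admissible T u v ->
  `[u, v[%classic = iet_dom T \/
  exists w U p q e, [/\ rauzy_step w T U, admissible T p q,
    is_induced_iet T `[p, q[%classic U, p <= u /\ v <= q &
    Div T u v e /\ ~ p <= e < q].
Proof.
move=> A1 reg adm; have [lu uv vr _ _] := adm.
have A0 := alphabet_gt0 T.
have [a la] := ex_least A0 (@le1_anti _ _ T) (@le1_trans _ _ T) (@le1_total _ _ T).
have [b lb] := ex_least2 T.
have [a' ga'] := ex_greatest (left_end T) (@le1_anti _ _ T) (@le1_trans _ _ T) (@le1_total _ _ T)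
  (@len_gt0 _ _ T) A0.
have [b' gb'] := ex_greatest (left_end T) (@le2_anti _ _ T) (@le2_trans _ _ T) (@le2_total _ _ T)
  (@len_gt0 _ _ T) A0.
have [pu|up] := lerP (Num.min (mu T a) (nu T b)) u.
  right; have adm' : admissible T (Num.min (mu T a) (nu T b)) (right_end T).
    by apply: admissible_left; exact: le_lt_trans pu (lt_le_trans uv vr).
  have [U ind] := admissible_induced A1 reg adm'.
  exists phi, U, (Num.min (mu T a) (nu T b)), (right_end T), (left_end T); split => //.
    by exists a, b.
  split; first exact: Div_left.
  move=> /andP[h _]; move: h; rewrite leNgt lt_min -(gamma_least la) gamma_lt_mu /=.
  by rewrite gamma_least // -(delta_left lb) -delta_nu ltrDl len_gt0.
have [vq|qv] := lerP v (Num.max (gamma T a') (delta T b')).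
  right; have adm' : admissible T (left_end T) (Num.max (gamma T a') (delta T b')).
    by apply: admissible_right; exact: le_lt_trans lu (lt_le_trans uv vq).
  have [U ind] := admissible_induced A1 reg adm'.
  exists psi, U, (left_end T), (Num.max (gamma T a') (delta T b')), (Num.max (gamma T a') (delta T b')).
  split => //; first by exists a', b'.
  split; last by rewrite ltxx andbF.
  move: vq; case: (leP (gamma T a') (delta T b')) => _ vq; last exact: Div_gamma.
  by apply: Div_delta => /andP[_]; rewrite ltNge vq.
by left; have [-> ->] := admissible_exhaust A1 reg la ga' lb gb' adm up qv.
Qed.

Lemma admissible_word T u v : (1 < #|A|)%N -> sep_free T -> admissible T u v ->
  exists chi S, rauzy_word chi T S /\ iet_dom S = `[u, v[%classic.
Proof.
move=> A1 reg adm; have [lu uv vr _ _] := adm.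
have [s hs] := Div_finite A1 reg lu uv vr.
have [n] := ubnP (size s); elim: n => // n IH in T reg adm lu vr s hs *.
move=> sn; have [->|[w [U [p [q [e [step adm' ind [pu vq] [De eJ]]]]]]]] := rauzy_progress A1 reg adm.
  by exists [::], T.
have regU := induced_sep_free A1 reg adm' ind.
have pq : p < q by case: adm'.
have [lU rU] := induced_ends pq (proj1 (proj1 ind)).
(* Inside [[p, q[] the sets Div for [U] and for [T] agree, so the filtered list still covers Div for
   [U]; it is shorter because [e] is dropped. *)
have [|||x|//|chi [S [word domS]]] := IH U regU _ _ _ [seq x <- s | p <= x < q].
- exact/(induced_admissible A1 reg adm' ind pu vq).
- by rewrite lU.
- by rewrite rU.
- move=> xD; have := Div_dom xD; rewrite iet_domE lU rU => xJ.
  by rewrite mem_filter xJ; apply: hs; apply/(induced_Div A1 reg adm' ind pu vq xJ).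
- rewrite ltnS in sn; apply: leq_trans sn; rewrite size_filter -(count_predC (fun x => p <= x < q) s).
  rewrite -[X in (X < _)%N]addn0 ltn_add2l -has_count; apply/hasP; exists e; first exact: hs.
  exact/negP.
by exists (rcons chi w), S; split => //; exact: rauzy_word_rcons step word.
Qed.

(** [T] is the identity, so Div is reduced to [left_end T]. *)
Lemma one_letter_admissible T u v : ~~ (1 < #|A|)%N -> admissible T u v ->
  u = left_end T /\ v = right_end T.
Proof.
move=> A1 [lu uv vr uD vD].
have gl a : gamma T a = left_end T.
  by apply: gamma_least => b; rewrite (one_letter b a A1) (le_reflexive (@le1_total _ _ T)).
have dl a : delta T a = left_end T.
  by apply: delta_left => b; rewrite (one_letter b a A1) (le_reflexive (@le2_total _ _ T)).
have idT x : iet_map T x = x.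
  have [/piece_cover[a xa]|nx] := pselect (iet_dom T x); last exact: iet_map_out.
  by rewrite (iet_mapE xa) gl dl subrr addr0.
have idn n x : iter n (iet_map T) x = x by elim: n => //= n ->.
have DE x : Div T u v x -> x = left_end T.
  by move=> [a _ /neighborsP[[n ->]|[n]]]; rewrite idn gl.
split.
  by case: uD => [/DE //|/= ur]; move: uv; rewrite ur ltNge vr.
by case: vD => [/DE vl|//]; move: (le_lt_trans lu uv); rewrite vl ltxx.
Qed.

End Rauzy.

Theorem theorem4p3 (R : realType) (A : finType) (T : iet R A) (u v : R) :
  let I : set R := `[u, v[%classic in
  iet_regular T -> I `<=` iet_dom T ->
  (admissible T u v <->
     exists (chi : seq rauzy) (S : iet R A),
       rauzy_word chi T S /\ iet_dom S = I) /\
  (forall (chi : seq rauzy) (S : iet R A),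
     rauzy_word chi T S -> iet_dom S = I -> is_induced T I S).
Proof.
move=> I /iet_regular_sep_free reg _; split; last first.
  by move=> chi S /rauzy_word_induced[ind _] <-.
split.
  have [A1|A1] := boolP (1 < #|A|)%N; first exact: admissible_word.
  by move=> /(one_letter_admissible A1)[uE vE]; exists [::], T; rewrite /I uE vE.
move=> [chi [S [/(rauzy_word_invariant reg)[_ _ _ admE] domS]]].
have : iet_dom S (left_end S) by rewrite iet_domE lexx left_lt_right.
rewrite domS /I /= in_itv /= => /andP[h1 h2]; have uv := le_lt_trans h1 h2.
have [lS rS] := induced_ends uv domS.
(* The whole domain of [S] is admissible for [S]: its left end is in Div and its right end is the
   exceptional point. *)
apply/admE; rewrite ?lS ?rS //; split => //; rewrite ?lS ?rS //.
  by left; rewrite -{2}lS; apply: Div_left; rewrite lS.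
by right.
Qed.
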